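(* Let $A\subset\mathbb{R}^d$ be a finite set of sites in general position. The rhomboid bifiltration $\mathrm{Rhomb}=(\mathrm{Rhomb}_{r,k})$ and the multicover bifiltration $\mathrm{Cov}=(\mathrm{Cov}_{r,k})$, indexed by $(r,k)\in[0,\infty)\times\mathbb{N}$, are weakly equivalent.
   Context: $\mathbb{N}=\{1,2,\dots\}$. Bifiltrations are indexed by $[0,\infty)\times\mathbb{N}$ with $(r,k)\le(r',k')$ iff $r\le r'$ and $k\ge k'$, consisting of spaces $X_{r,k}$ with $X_{r,k}\subseteq X_{r',k'}$ for $(r,k)\le(r',k')$. A morphism is a family of continuous maps commuting with the inclusions; it is an objectwise homotopy equivalence if each component is a homotopy equivalence; two bifiltrations are weakly equivalent if connected by a finite zigzag of objectwise homotopy equivalences. $\mathrm{Cov}_{r,k}=\{b\in\mathbb{R}^d: \|b-a\|\le r \text{ for at least } k \text{ points } a\in A\}$. A $(d-1)$-sphere $S\subset\mathbb{R}^d$ partitions $A=A_{in}\sqcup A_{on}\sqcup A_{out}$ (sites inside, on, outside $S$). The combinatorial rhomboid of $S$ is $\rho_S=\{A_{in}\cup Q: Q\subseteq A_{on}\}$; a vertex $v=\{a_1,\dots,a_m\}$ is embedded as $(\sum_i a_i,-m)\in\mathbb{R}^{d+1}$ (depth $m$), and the geometric rhomboid is the convex hull of its embedded vertices. The rhomboid tiling is the polyhedral complex in $\mathbb{R}^{d+1}$ of all rhomboids $\rho_S$, $S$ ranging over all spheres. For a rhomboid $\rho$, $r_\rho$ is the infimum of radii of spheres $S$ with $\rho_S=\rho$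 and $k_\rho$ is the minimum depth among its vertices. $\mathrm{Rhomb}_{r,k}$ is the union of the rhomboids $\rho$ with $r_\rho\le r$ and $k_\rho\ge k$. *)

(* Defs.v *)
From HB Require Import structures.
From mathcomp Require Import all_boot all_order all_algebra.
From mathcomp Require Import all_classical all_reals all_analysis.
Set Implicit Arguments. Unset Strict Implicit. Unset Printing Implicit Defensive.
Import Order.TTheory GRing.Theory Num.Theory numFieldNormedType.Exports.
Local Open Scope classical_set_scope.
Local Open Scope ring_scope.

Definition enorm2 {R : realType} {d : nat} (x : 'rV[R]_d) : R :=
  \sum_(j < d) x ord0 j ^+ 2.

(* The finite set A of sites is the image of an injective map a : 'I_n -> R^d. *)

Definition general_position {R : realType} {d n : nat} (a : 'I_n -> 'rV[R]_d) : Prop :=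
  injective a /\
  (forall B : {set 'I_n}, (#|B| <= d.+1)%N ->
     forall l : 'I_n -> R, \sum_(i in B) l i = 0 ->
       \sum_(i in B) l i *: a i = 0 -> forall i, i \in B -> l i = 0) /\
  (forall B : {set 'I_n}, (d.+2 <= #|B|)%N ->
     ~ (exists (c : 'rV[R]_d) (rho : R), 0 < rho /\
          forall i, i \in B -> enorm2 (a i - c) = rho ^+ 2)).

Definition Cov {R : realType} {d n : nat} (a : 'I_n -> 'rV[R]_d)
  (r : R) (k : nat) : set 'rV[R]_d :=
  [set b | (k <= #|[set i : 'I_n | (enorm2 (b - a i) <= r ^+ 2)%R]|)%N].

Definition sph_in {R : realType} {d n : nat} (a : 'I_n -> 'rV[R]_d)
  (c : 'rV[R]_d) (rho : R) : {set 'I_n} :=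
  [set i | (enorm2 (a i - c) < rho ^+ 2)%R].
Definition sph_on {R : realType} {d n : nat} (a : 'I_n -> 'rV[R]_d)
  (c : 'rV[R]_d) (rho : R) : {set 'I_n} :=
  [set i | (enorm2 (a i - c) == rho ^+ 2)%R].

Definition comb_rhomboid {R : realType} {d n : nat} (a : 'I_n -> 'rV[R]_d)
  (c : 'rV[R]_d) (rho : R) : {set {set 'I_n}} :=
  [set v : {set 'I_n} | (sph_in a c rho \subset v) &&
           (v \subset sph_in a c rho :|: sph_on a c rho)].

Definition is_rhomboid {R : realType} {d n : nat} (a : 'I_n -> 'rV[R]_d)
  (P : {set {set 'I_n}}) : Prop :=
  exists (c : 'rV[R]_d) (rho : R), 0 < rho /\ comb_rhomboid a c rho = P.

Definition r_rhomb {R : realType} {d n : nat} (a : 'I_n -> 'rV[R]_d)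
  (P : {set {set 'I_n}}) : R :=
  inf [set s : R | exists c : 'rV[R]_d, 0 < s /\ comb_rhomboid a c s = P].

Definition embed_vertex {R : realType} {d n : nat} (a : 'I_n -> 'rV[R]_d)
  (v : {set 'I_n}) : 'rV[R]_(d + 1) :=
  row_mx (\sum_(i in v) a i) (const_mx (- (#|v|%:R))).

Definition geom_rhomboid {R : realType} {d n : nat} (a : 'I_n -> 'rV[R]_d)
  (P : {set {set 'I_n}}) : set 'rV[R]_(d + 1) :=
  [set x | exists w : {set 'I_n} -> R,
     (forall v, 0 <= w v) /\ \sum_(v in P) w v = 1 /\
     x = \sum_(v in P) w v *: embed_vertex a v].

Definition Rhomb {R : realType} {d n : nat} (a : 'I_n -> 'rV[R]_d)
  (r : R) (k : nat) : set 'rV[R]_(d + 1) :=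
  [set x | exists P : {set {set 'I_n}},
     is_rhomboid a P /\ r_rhomb a P <= r /\
     (forall v, v \in P -> (k <= #|v|)%N) /\ geom_rhomboid a P x].

Definition maps_into {T U : Type} (f : T -> U) (X : set T) (Y : set U) : Prop :=
  forall x, X x -> Y (f x).

Definition homotopic {R : realType} {T U : topologicalType}
  (X : set T) (Y : set U) (f g : T -> U) : Prop :=
  exists H : T * R -> U,
    {within X `*` [set t : R | 0 <= t <= 1], continuous H} /\
    (forall x t, X x -> 0 <= t <= 1 -> Y (H (x, t))) /\
    (forall x, X x -> H (x, 0) = f x /\ H (x, 1) = g x).

Definition homotopy_equiv {R : realType} {T U : topologicalType}
  (X : set T) (Y : set U) (f : T -> U) : Prop :=
  maps_into f X Y /\ {within X, continuous f} /\
  exists g : U -> T, maps_into g Y X /\ {within Y, continuous g} /\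
    @homotopic R T T X X (g \o f) id /\ @homotopic R U U Y Y (f \o g) id.

(* a (candidate) bifiltration: spaces X_{r,k} as subspaces of a topological
   space, indexed by r : R (meaningful for r >= 0) and k : nat (k >= 1) *)
Record bifilt (R : realType) := BiFilt {
  bf_T : topologicalType;
  bf_X : R -> nat -> set bf_T }.

Definition is_bifilt {R : realType} (B : bifilt R) : Prop :=
  forall (r r' : R) (k k' : nat), 0 <= r -> r <= r' -> (1 <= k')%N -> (k' <= k)%N ->
    @bf_X R B r k `<=` @bf_X R B r' k'.

Definition objwise_he {R : realType} (B C : bifilt R) : Prop :=
  exists f : R -> nat -> @bf_T R B -> @bf_T R C,
    (forall r k, 0 <= r -> (1 <= k)%N ->
       @homotopy_equiv R _ _ (@bf_X R B r k) (@bf_X R C r k) (f r k)) /\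
    (forall (r r' : R) (k k' : nat) x, 0 <= r -> r <= r' -> (1 <= k')%N ->
       (k' <= k)%N -> @bf_X R B r k x -> f r' k' x = f r k x).

Inductive zigzag {R : realType} : bifilt R -> bifilt R -> Prop :=
  | zz_refl B : zigzag B B
  | zz_fwd B C D : is_bifilt C -> objwise_he B C -> zigzag C D -> zigzag B D
  | zz_bwd B C D : is_bifilt C -> objwise_he C B -> zigzag C D -> zigzag B D.

Definition weakly_equivalent {R : realType} (B C : bifilt R) : Prop :=
  is_bifilt B /\ zigzag B C.

Definition CovBF {R : realType} {d n : nat} (a : 'I_n -> 'rV[R]_d) : bifilt R :=
  @BiFilt R 'rV[R]_d (Cov a).
Definition RhombBF {R : realType} {d n : nat} (a : 'I_n -> 'rV[R]_d) : bifilt R :=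
  @BiFilt R 'rV[R]_(d + 1) (Rhomb a).

(* Main.v *)
(* Record a sphere with centre c and squared radius s as (c, s - |c|^2): then
   s - |a - c|^2 is affine in the sphere for each site a, the sites inside, on
   and outside a sphere are read off a hyperplane arrangement, and the rhomboid
   tiling is its dual.  In general position a point of the tiling is a unique
   combination of the (a_i, -1) with coefficients lam_i in [0, 1], equal to 1 on
   the inner and to 0 on the outer sites of some sphere.

   The two bifiltrations are linked by the space of pairs (lam, c) with lam in
   the tiling and c at distance at most r of every a_i with lam_i = 1, projected
   to lam and to c.  The fibres of the first projection are convex, and a
   partition of unity provides a section.  The second one is inverted as
   follows.  The site coefficient lam_i(q) is a function of the power of a_i with
   respect to a sphere q that climbs from 0 to 1 in a thin layer; for a thin
   enough layer the result is in the tiling, because in general position the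
   sites in the layer lie exactly on some sphere near q.  Applied to the sphere
   around c of radius slightly above r this gives a map back; to contract the
   composition, join that sphere linearly to a sphere depending continuously on
   lam (again by a partition of unity) which strictly contains at least k of the
   sites with lam_i = 1.  All remaining homotopies are linear inside one rhomboid. *)
Require Import Defs.
From HB Require Import structures.
From mathcomp Require Import all_boot all_order all_algebra.
From mathcomp Require Import all_classical all_reals all_analysis.
From mathcomp Require Import ring lra.
Set Implicit Arguments. Unset Strict Implicit. Unset Printing Implicit Defensive.
Import Order.TTheory GRing.Theory Num.Theory numFieldNormedType.Exports.
Local Open Scope classical_set_scope.
Local Open Scope ring_scope.

(** * Spheres as points of an arrangement *)

Section Dot.
Variables (R : realType) (m : nat).
Implicit Types (x y z : 'rV[R]_m).

Definition dot x y : R := \sum_j x ord0 j * y ord0 j.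

Lemma dotC x y : dot x y = dot y x.
Proof. by apply: eq_bigr => j _; rewrite mulrC. Qed.

Lemma dotDr x y z : dot x (y + z) = dot x y + dot x z.
Proof. by rewrite -big_split; apply: eq_bigr => j _; rewrite mxE mulrDr. Qed.

Lemma dotZr x (u : R) y : dot x (u *: y) = u * dot x y.
Proof. by rewrite mulr_sumr; apply: eq_bigr => j _; rewrite mxE mulrCA. Qed.

Lemma dotBr x y z : dot x (y - z) = dot x y - dot x z.
Proof. by rewrite -[- z]scaleN1r dotDr dotZr mulN1r. Qed.

Lemma dot_sumr x (K : Type) (s : seq K) (P : pred K) (F : K -> 'rV[R]_m) :
  dot x (\sum_(k <- s | P k) F k) = \sum_(k <- s | P k) dot x (F k).
Proof.
elim/big_rec2: _ => [|k u v _ <-]; last by rewrite dotDr.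
by rewrite /dot big1 // => j _; rewrite mxE mulr0.
Qed.

Lemma dotZl x (u : R) y : dot (u *: y) x = u * dot y x.
Proof. by rewrite dotC dotZr dotC. Qed.

Lemma dotBl x y z : dot (y - z) x = dot y x - dot z x.
Proof. by rewrite dotC dotBr !(dotC x). Qed.

Lemma dot_suml x (K : Type) (s : seq K) (P : pred K) (F : K -> 'rV[R]_m) :
  dot (\sum_(k <- s | P k) F k) x = \sum_(k <- s | P k) dot (F k) x.
Proof. by rewrite dotC dot_sumr; apply: eq_bigr => k _; rewrite dotC. Qed.

Lemma enorm2E x : enorm2 x = dot x x.
Proof. by apply: eq_bigr => j _; rewrite expr2. Qed.

Lemma enorm2_ge0 x : 0 <= enorm2 x.
Proof. by apply: sumr_ge0 => j _; rewrite sqr_ge0. Qed.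

Lemma enorm2_eq0 x : enorm2 x = 0 -> x = 0.
Proof.
move=> x0; apply/rowP => j; rewrite mxE; apply/eqP; rewrite -sqrf_eq0; apply/eqP.
by apply: (psumr_eq0P _ x0) => // i _; rewrite sqr_ge0.
Qed.

Lemma enorm2B x y : enorm2 (x - y) = enorm2 x - 2 * dot x y + enorm2 y.
Proof. by rewrite !enorm2E !(dotBl, dotBr) (dotC y x); ring. Qed.

Lemma enorm2N x : enorm2 (- x) = enorm2 x.
Proof. by apply: eq_bigr => j _; rewrite mxE sqrrN. Qed.

Lemma enorm2Bsym x y : enorm2 (x - y) = enorm2 (y - x).
Proof. by rewrite -enorm2N opprB. Qed.

End Dot.

Lemma dot_row (R : realType) (m1 m2 : nat) (x y : 'rV[R]_m1) (x' y' : 'rV[R]_m2) :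
  dot (row_mx x x') (row_mx y y') = dot x y + dot x' y'.
Proof.
by rewrite /dot big_split_ord; congr (_ + _); apply: eq_bigr => j _;
  rewrite ?row_mxEl ?row_mxEr.
Qed.

Lemma dot1 (R : realType) (x y : 'rV[R]_1) : dot x y = x ord0 ord0 * y ord0 ord0.
Proof. by rewrite /dot big_ord1. Qed.

Section Spheres.
Variables (R : realType) (d : nat).
Implicit Types (z c : 'rV[R]_d) (p q : 'rV[R]_(d + 1)).

(* The sphere of centre c and squared radius s is the row (c, s - |c|^2); in
   these coordinates the power of a fixed point z is an affine function. *)
Definition cen p : 'rV[R]_d := lsubmx p.
Definition sq p : R := rsubmx p ord0 ord0 + enorm2 (cen p).
Definition sph c (s : R) : 'rV[R]_(d + 1) := row_mx c (const_mx (s - enorm2 c)).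
Definition nrm z : 'rV[R]_(d + 1) := row_mx (2 *: z) (const_mx 1).
Definition pw z p : R := dot (nrm z) p - enorm2 z.

Lemma cen_sph c s : cen (sph c s) = c.
Proof. by rewrite /cen row_mxKl. Qed.

Lemma sq_sph c s : sq (sph c s) = s.
Proof. by rewrite /sq cen_sph row_mxKr mxE subrK. Qed.

Lemma sphE p : sph (cen p) (sq p) = p.
Proof.
rewrite /sph /sq addrK -[RHS]hsubmxK; congr row_mx.
by apply/rowP => j; rewrite [j]ord1 !mxE.
Qed.

Lemma pwE z p : pw z p = sq p - enorm2 (z - cen p).
Proof.
rewrite /pw -{1}(hsubmxK p) dot_row dotZl dot1 mxE mul1r enorm2B /sq /cen.
by ring.
Qed.

Lemma pw_sph z c s : pw z (sph c s) = s - enorm2 (z - c).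
Proof. by rewrite pwE sq_sph cen_sph. Qed.

Lemma pwD z p q : pw z (p + q) = pw z p + dot (nrm z) q.
Proof. by rewrite /pw dotDr addrAC. Qed.

Lemma pw_le_sq z p : pw z p <= sq p.
Proof. by rewrite pwE lerBlDr lerDl enorm2_ge0. Qed.

Lemma pw_cen p : pw (cen p) p = sq p.
Proof. by rewrite pwE subrr -(scale0r 0) enorm2E dotZl mul0r subr0. Qed.

Lemma pw_conv (K : finType) (w : K -> R) (P : K -> 'rV[R]_(d + 1)) z :
  \sum_k w k = 1 -> pw z (\sum_k w k *: P k) = \sum_k w k * pw z (P k).
Proof.
move=> w1; rewrite [RHS](eq_bigr (fun k => w k * dot (nrm z) (P k) - w k * enorm2 z)).
  2: by move=> k _; rewrite -mulrBr.
rewrite sumrB -mulr_suml w1 mul1r /pw dot_sumr; congr (_ - _).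
by apply: eq_bigr => k _; rewrite dotZr.
Qed.

Lemma pw_lerp z p q (u : R) :
  pw z ((1 - u) *: p + u *: q) = (1 - u) * pw z p + u * pw z q.
Proof. by rewrite /pw dotDr !dotZr; ring. Qed.

(** The squared radius of the combination is the power of its own centre. For a fixed point that
    power is affine in the sphere, and it is at most the squared radius of each [P k]. *)
Lemma sq_conv (K : finType) (w : K -> R) (P : K -> 'rV[R]_(d + 1)) (s : R) :
  (forall k, 0 <= w k) -> \sum_k w k = 1 ->
  (forall k, w k != 0 -> sq (P k) <= s) -> sq (\sum_k w k *: P k) <= s.
Proof.
move=> w0 w1 Ps; rewrite -pw_cen pw_conv // -[s]mul1r -w1 mulr_suml.
apply: ler_sum => k _; have [->|wk] := eqVneq (w k) 0; first by rewrite !mul0r.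
by rewrite ler_wpM2l // (le_trans (pw_le_sq _ _)) // Ps.
Qed.

Lemma sq_lerp p q (u s : R) : 0 <= u <= 1 -> sq p <= s -> sq q <= s ->
  sq ((1 - u) *: p + u *: q) <= s.
Proof.
move=> u01 ps qs; rewrite -pw_cen pw_lerp.
set z := cen _.
have := le_trans (pw_le_sq z p) ps; have := le_trans (pw_le_sq z q) qs; nra.
Qed.

Lemma ball_conv (K : finType) (w : K -> R) (c : K -> 'rV[R]_d) z (s : R) :
  (forall k, 0 <= w k) -> \sum_k w k = 1 ->
  (forall k, w k != 0 -> enorm2 (c k - z) <= s) ->
  enorm2 (\sum_k w k *: c k - z) <= s.
Proof.
move=> w0 w1 cs.
(* With last coordinate 0, [sq] is the squared norm of the centre, so convexity of balls is a case
   of [sq_conv]. *)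
pose P k : 'rV[R]_(d + 1) := row_mx (c k - z) (const_mx 0).
have Psq k : sq (P k) = enorm2 (c k - z).
  by rewrite /sq /cen row_mxKl row_mxKr mxE add0r.
have Ps : sq (\sum_k w k *: P k) <= s by apply: sq_conv => // k wk; rewrite Psq cs.
suff PE : \sum_k w k *: P k = row_mx (\sum_k w k *: c k - z) (const_mx 0).
  by move: Ps; rewrite PE /sq /cen row_mxKl row_mxKr mxE add0r.
apply/rowP => j; rewrite summxE; case: (split_ordP j) => i ->.
  rewrite row_mxEl !mxE summxE -[z _ _]mul1r -w1 mulr_suml -sumrB.
  by apply: eq_bigr => k _; rewrite mxE row_mxEl !mxE mulrBr.
by rewrite row_mxEr mxE big1 // => k _; rewrite mxE row_mxEr mxE mulr0.
Qed.

End Spheres.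

(** Turns constants found separately for each face or set of sites into one uniform constant. *)
Lemma finite_upper_bound (R : realType) (K : finType) (P : K -> R -> Prop) :
  (forall k x y, x <= y -> P k x -> P k y) -> (forall k, exists x, P k x) ->
  exists2 x, 0 <= x & forall k, P k x.
Proof.
move=> Pmono /choice[f Pf]; exists (\sum_k `|f k|); first exact: sumr_ge0.
move=> k; apply: Pmono (Pf k); rewrite (bigD1 k) //=.
by rewrite (le_trans (ler_norm _)) // lerDl sumr_ge0.
Qed.

Lemma finite_lower_bound (R : realType) (K : finType) (P : K -> R -> Prop) :
  (forall k x y, y <= x -> P k x -> P k y) -> (forall k, exists2 x, 0 < x & P k x) ->
  exists2 x, 0 < x & forall k, P k x.
Proof.
move=> Pmono Pex.
have [//|k|x x0 Px] := @finite_upper_bound R K (fun k x => forall y, 0 < y -> x <= y^-1 -> P k y).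
- by move=> k x y xy Px z z0 yz; apply: Px z0 (le_trans xy yz).
- have [x x0 Px] := Pex k; exists x^-1 => y y0; rewrite lef_pV2 // => yx.
  exact: Pmono yx Px.
- exists (1 + x)^-1; first by rewrite invr_gt0; lra.
  by move=> k; apply: Px; rewrite ?invr_gt0 ?invrK; lra.
Qed.

(** * Consequences of general position *)

Section GeneralPosition.
Variables (R : realType) (d n : nat) (a : 'I_n -> 'rV[R]_d).
Hypothesis gpa : general_position a.
Implicit Types (p q : 'rV[R]_(d + 1)) (M B : {set 'I_n}).

(** Affine independence of the sites in [M] makes the rows [nrm (a i)] linearly independent; the
    columns of a right inverse of their matrix are the dual vectors. *)
Lemma exists_dual_basis M : (#|M| <= d.+1)%N ->
  exists V : 'I_n -> 'rV[R]_(d + 1),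
    {in M &, forall i j, dot (nrm (a i)) (V j) = (i == j)%:R}.
Proof.
move=> Md; have [_ [indep _]] := gpa.
pose A : 'M[R]_(#|M|, d + 1) := \matrix_(k, l) nrm (a (enum_val k)) ord0 l.
have rowA k : row k A = nrm (a (enum_val k)) by apply/rowP => l; rewrite !mxE.
have Afree : row_free A.
  apply: inj_row_free => v vA0.
  pose l i := \sum_(k < #|M| | enum_val k == i) v ord0 k.
  have lE k : l (enum_val k) = v ord0 k.
    by rewrite /l (big_pred1 k) // => k'; rewrite /= (inj_eq enum_val_inj).
  have sumE (T : lmodType R) (F : 'I_n -> T) :
      \sum_(i in M) l i *: F i = \sum_k v ord0 k *: F (enum_val k).
    by rewrite big_enum_val; apply: eq_bigr => k _; rewrite lE.
  have vN0 : \sum_(i in M) l i *: nrm (a i) = 0.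
    by rewrite sumE -[RHS]vA0 mulmx_sum_row; apply: eq_bigr => k _; rewrite rowA.
  have l0 : \sum_(i in M) l i = 0.
    move/rowP/(_ (rshift d ord0)): vN0; rewrite summxE mxE => vN0.
    by rewrite -[RHS]vN0; apply: eq_bigr => i _; rewrite mxE row_mxEr mxE mulr1.
  have la0 : \sum_(i in M) l i *: a i = 0.
    apply/rowP => j; move/rowP/(_ (lshift 1 j)): vN0; rewrite !summxE !mxE => vN0.
    apply: (@mulfI R 2); first by rewrite pnatr_eq0.
    rewrite mulr0 -[RHS]vN0 mulr_sumr; apply: eq_bigr => i _.
    by rewrite mxE [in RHS]mxE row_mxEl mxE mulrCA.
  apply/rowP => k; rewrite -lE mxE.
  exact: indep _ Md _ l0 la0 _ (enum_valP k).
pose C := pinvmx A; have AC : A *m C = 1%:M by rewrite mulmxVp.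
exists (fun j => \sum_(k < #|M| | enum_val k == j) (col k C)^T) => i j iM jM.
have [k -> {iM}] : exists k, i = @enum_val _ (mem M) k.
  by exists (enum_rank_in iM i); rewrite enum_rankK_in.
have [k' -> {jM}] : exists k, j = @enum_val _ (mem M) k.
  by exists (enum_rank_in jM j); rewrite enum_rankK_in.
rewrite (big_pred1 k') => [|k1]; last by rewrite /= (inj_eq enum_val_inj).
rewrite (inj_eq enum_val_inj); move/matrixP/(_ k k'): AC; rewrite !mxE => <-.
by apply: eq_bigr => l _; rewrite !mxE.
Qed.

(** A shift along the dual basis alters the powers of the sites in [M] independently. [C] depends on
    [M] only and also controls the other powers and the coordinates. *)
Lemma solve_powers M : (#|M| <= d.+1)%N ->
  exists2 C : R, 0 <= C & forall q (y : 'I_n -> R) (e : R), 0 <= e ->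
    (forall i, i \in M -> `|y i - pw (a i) q| <= e) ->
    exists v, [/\ forall i, i \in M -> pw (a i) (q + v) = y i,
      forall i, `|dot (nrm (a i)) v| <= C * e & forall l, `|v ord0 l| <= C * e].
Proof.
move=> /exists_dual_basis[V VE].
pose C1 := \sum_i \sum_j `|dot (nrm (a i)) (V j)|.
pose C2 := \sum_l \sum_j `|V j ord0 l|.
have C1_ge0 : 0 <= C1 by rewrite !sumr_ge0 // => *; rewrite sumr_ge0.
have C2_ge0 : 0 <= C2 by rewrite !sumr_ge0 // => *; rewrite sumr_ge0.
exists (C1 + C2) => [|q y e e_ge0 ye]; first exact: addr_ge0.
pose v := \sum_(j in M) (y j - pw (a j) q) *: V j.
have bound (F : 'I_n -> R) : `|\sum_(j in M) (y j - pw (a j) q) * F j| <= (\sum_j `|F j|) * e.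
  rewrite (le_trans (ler_norm_sum _ _ _)) // mulr_suml [leRHS](bigID (mem M)) /=.
  rewrite ler_wpDr ?sumr_ge0 // => [*|]; first exact: mulr_ge0.
  by apply: ler_sum => j jM; rewrite normrM mulrC ler_wpM2l // ye.
exists v; split => [i iM|i|l].
- rewrite pwD /v dot_sumr.
  rewrite (bigD1 i iM) /=.
  rewrite dotZr.
  rewrite (VE i i iM iM).
  rewrite eqxx mulr1 big1.
    by rewrite addr0 addrC subrK.
  by move=> j /andP[jM ji]; rewrite dotZr (VE i j iM jM) eq_sym (negPf ji) mulr0.
- rewrite /v dot_sumr; under eq_bigr do rewrite dotZr.
  rewrite (le_trans (bound _)) // ler_wpM2r // ler_wpDr //.
  by rewrite /C1 [leRHS](bigD1 i) //= lerDl sumr_ge0 // => *; rewrite sumr_ge0.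
- rewrite /v summxE; under eq_bigr do rewrite mxE.
  rewrite (le_trans (bound _)) // ler_wpM2r // ler_wpDl //.
  by rewrite /C2 [leRHS](bigD1 l) //= lerDl sumr_ge0 // => *; rewrite sumr_ge0.
Qed.

Lemma card_cospherical B p : (forall i, i \in B -> pw (a i) p = 0) -> (#|B| <= d.+1)%N.
Proof.
move=> Bp; rewrite leqNgt; apply/negP => Bd; have [ainj [_ ncs]] := gpa.
have sqE i : i \in B -> enorm2 (a i - cen p) = sq p.
  by move=> /Bp; rewrite pwE => /eqP; rewrite subr_eq0 => /eqP.
have [i [j [iB jB ij]]] : exists i j, [/\ i \in B, j \in B & i != j].
  by apply/card_gt1P; apply: leq_trans Bd.
(* [general_position] speaks of positive radii; at squared radius 0 two distinct sites of [B] would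
   both equal the centre. *)
have sq_gt0 : 0 < sq p.
  rewrite lt_def -(sqE i) // enorm2_ge0 andbT; apply/eqP => sq0.
  move: (sqE j jB); rewrite -(sqE i iB) sq0 => /enorm2_eq0/subr0_eq aj.
  by move/enorm2_eq0/subr0_eq: sq0 => ai; rewrite (ainj i j) ?eqxx ?ai ?aj in ij.
apply: (ncs B Bd); exists (cen p), (Num.sqrt (sq p)).
by rewrite sqrtr_gt0 sq_gt0; split=> // i' /sqE ->; rewrite sqr_sqrtr // ltW.
Qed.

(** The d + 2 normals live in dimension d + 1, so a nontrivial combination of the powers is the same
    constant for all spheres. The constant is nonzero, so the powers cannot all be small. *)
Lemma far_from_cospherical B : #|B| = d.+2 ->
  exists2 eta : R, 0 < eta & forall p, exists2 i, i \in B & eta <= `|pw (a i) p|.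
Proof.
move=> Bd; pose b := @enum_val _ (mem B).
have bB k : b k \in B by exact: enum_valP.
pose A : 'M[R]_(#|B|, d + 1) := \matrix_(k, l) nrm (a (b k)) ord0 l.
have [u uA u0] : exists2 u : 'rV_#|B|, u *m A = 0 & u != 0.
  have /rowV0Pn[u /sub_kermxP uA u0] : kermx A != 0; last by exists u.
  rewrite -mxrank_eq0 mxrank_ker subn_eq0 -ltnNge.
  by rewrite (leq_ltn_trans (rank_leq_col A)) // Bd addn1.
pose c := \sum_k u ord0 k * enorm2 (a (b k)).
have upw p : \sum_k u ord0 k * pw (a (b k)) p = - c.
  rewrite /pw; under eq_bigr do rewrite mulrBr.
  rewrite sumrB -/c -[RHS]add0r; congr (_ - _).
  have -> : \sum_k u ord0 k * dot (nrm (a (b k))) p = dot (u *m A) p.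
    rewrite mulmx_sum_row dot_suml; apply: eq_bigr => k _; rewrite dotZl; congr (_ * dot _ _).
    by apply/rowP => l; rewrite !mxE.
  by rewrite uA -(scale0r 0) dotZl mul0r.
(* Otherwise a sphere through all sites of [B] but one, whose coefficient is nonzero, would pass
   through that one too, against [card_cospherical]. *)
have c0 : c != 0.
  apply/eqP => c0; have [k uk0] : exists k, u ord0 k != 0.
    by apply/existsP; apply: contraNT u0; rewrite negb_exists => /forallP u0;
      apply/eqP/rowP => k; rewrite mxE; apply/eqP; rewrite -[_ == _]negbK u0.
  pose M := B :\ b k.
  have Md : (#|M| <= d.+1)%N by move: Bd; rewrite (cardsD1 (b k)) bB add1n => -[->].
  have [C _ /(_ 0 (fun=> 0) (\sum_i `|pw (a i) 0|))] := solve_powers Md.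
  case=> [|i iM|v [v0 _ _]]; first exact: sumr_ge0.
    by rewrite sub0r normrN (bigD1 i) //= lerDl sumr_ge0.
  have /card_cospherical : forall i, i \in B -> pw (a i) (0 + v) = 0; last by rewrite Bd ltnn.
  move=> i iB; have [->|ik] := eqVneq i (b k); last first.
    by apply: v0; rewrite !inE ik.
  apply: (mulfI uk0); rewrite mulr0; move: (upw (0 + v)); rewrite c0 oppr0 (bigD1 k) //=.
  rewrite [X in _ + X]big1 ?addr0 // => k' k'k; rewrite v0 ?mulr0 //.
  by rewrite !inE (inj_eq (@enum_val_inj _ (mem B))) k'k bB.
pose U := \sum_k `|u ord0 k|; have U0 : 0 <= U by apply: sumr_ge0.
(* If all powers were below this value, the relation would give |c| <= U |c| / (1 + U) < |c|. *)
exists (`|c| / (1 + U)) => [|p]; first by rewrite divr_gt0 ?normr_gt0 //; lra.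
apply/exists2P; apply: contrapT => /forallNP far.
have small k : `|pw (a (b k)) p| <= `|c| / (1 + U).
  by rewrite leNgt; apply/negP => lek; apply: (far (b k)); split; [exact: bB | exact: ltW].
have : `|c| <= U * (`|c| / (1 + U)).
  rewrite -[leLHS]normrN -(upw p) (le_trans (ler_norm_sum _ _ _)) // mulr_suml.
  by apply: ler_sum => k _; rewrite normrM ler_wpM2l ?small.
rewrite mulrA ler_pdivlMr; last lra.
have : 0 < `|c| by rewrite normr_gt0.
rewrite mulrDr mulr1 [U * _]mulrC => c_gt0; rewrite gerDr leNgt c_gt0 //.
Qed.

Lemma few_small_powers : exists2 eta : R, 0 < eta &
  forall p, (#|[set i | (`|pw (a i) p| < eta)%R]%SET| <= d.+1)%N.
Proof.
have [||eta eta0 etaP] := @finite_lower_bound R {set 'I_n} (fun B eta =>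
  #|B| = d.+2 -> forall p, exists2 i, i \in B & eta <= `|pw (a i) p|).
- by move=> B x y yx Bx Bd p; have [i iB xi] := Bx Bd p; exists i => //; apply: le_trans xi.
- move=> B; have [Bd|Bd] := eqVneq #|B| d.+2; last by exists 1 => // /eqP; rewrite (negPf Bd).
  by have [eta eta0 etaP] := far_from_cospherical Bd; exists eta.
exists eta => // p; set M := [set i | _]%SET; rewrite leqNgt; apply/negP => Md.
pose B := [set i in take d.+2 (enum M)].
have Bd : #|B| = d.+2.
  rewrite cardsE; apply/eqP; move/card_uniqP: (take_uniq d.+2 (enum_uniq M)) => ->.
  by rewrite size_takel // -cardE.
have [i] := etaP B Bd p; rewrite inE => /mem_take; rewrite mem_enum inE ltNge.
by move=> /negPf ->.
Qed.

End GeneralPosition.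

(** * Cells of the arrangement *)

Section Cells.
Variables (R : realType) (d n : nat) (a : 'I_n -> 'rV[R]_d).
Implicit Types (p q : 'rV[R]_(d + 1)) (I J : {set 'I_n}) (lam : 'rV[R]_n).

(** At most d + 1 sites have small power, so these powers can be prescribed: those below [eta] in
    absolute value become 0, and the correction is too small to move any other site across the
    sphere. The bound on the centre is there because [sq] is quadratic. *)
Lemma snap_to_sphere (b e : R) : general_position a -> 0 < e ->
  exists2 eta0 : R, 0 < eta0 & forall eta q, 0 < eta <= eta0 -> enorm2 (cen q) <= b ->
    exists p, [/\ sq p <= sq q + e, forall i, (0 < pw (a i) p) = (eta <= pw (a i) q)
      & forall i, (0 <= pw (a i) p) = (- eta < pw (a i) q)].
Proof.
move=> gpa e0; have [eta1 eta1_gt0 few] := few_small_powers gpa.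
have [||C C0 CP] := @finite_upper_bound R {set 'I_n} (fun M C =>
    (#|M| <= d.+1)%N -> forall q (y : 'I_n -> R) (e : R), 0 <= e ->
    (forall i, i \in M -> `|y i - pw (a i) q| <= e) ->
    exists v, [/\ forall i, i \in M -> pw (a i) (q + v) = y i,
      forall i, `|dot (nrm (a i)) v| <= C * e & forall l, `|v ord0 l| <= C * e]).
- move=> M x y xy Mx Md q z e1 e1_ge0 ze1; have [v [v1 v2 v3]] := Mx Md q z e1 e1_ge0 ze1.
  have xye : x * e1 <= y * e1 by rewrite ler_wpM2r.
  by exists v; split => // i; [apply: le_trans (v2 i) _|apply: le_trans (v3 i) _].
- move=> M; have [Md|Md] := leqP #|M| d.+1; last by exists 0.
  by have [C _ CP] := solve_powers gpa Md; exists C.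
(* A correction of size [mu] increases the squared radius by at most [mu * Z]: 1 for the last
   coordinate, |b| + 2d for the centre. *)
pose Z := 1 + `|b| + (2 * d)%:R; have Z1 : 1 <= Z.
  by rewrite /Z -addrA lerDl addr_ge0.
have C1 : 0 < C + 1 by lra.
pose m := Num.min eta1 (Num.min 1 (e / Z)).
have m_gt0 : 0 < m by rewrite !lt_min eta1_gt0 ltr01 divr_gt0 //; lra.
exists (m / (C + 1)) => [|eta q /andP[eta0 etam] qb]; first by rewrite divr_gt0.
move: etam; rewrite ler_pdivlMr // !le_min => /and3P[mu1 mu2].
rewrite ler_pdivlMr; last by lra.
set mu := C * eta; have mu0 : 0 <= mu by rewrite mulr_ge0 // ltW.
have -> : eta * (C + 1) = mu + eta by rewrite /mu; ring.
move=> mu3; have {}mu3 : mu * Z <= e by nra.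
have {mu2} mu_le1 : mu <= 1 by move: mu2; rewrite mulrDr mulr1 mulrC -/mu; lra.
have {}mu1 : mu + eta <= eta1 by move: mu1; rewrite mulrDr mulr1 mulrC.
(* All powers move by at most [mu], so outside [M] they keep their sign and stay at least [eta] in
   absolute value. *)
pose M := [set i | (`|pw (a i) q| < mu + eta)%R]%SET.
have Md : (#|M| <= d.+1)%N.
  apply: leq_trans (few q); apply: subset_leq_card; apply/fintype.subsetP => i; rewrite !inE.
  by move=> /lt_le_trans; apply.
pose y i := if `|pw (a i) q| < eta then 0 else pw (a i) q.
have [|i _|v [v1 v2 v3]] := CP M Md q y eta; first exact: ltW.
  rewrite /y; case: ifPn => [yeta|_]; first by rewrite sub0r normrN ltW.
  by rewrite subrr normr0 ltW.
rewrite -/mu in v2 v3.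
have pwE i : (0 < pw (a i) (q + v)) = (eta <= pw (a i) q) /\
             (0 <= pw (a i) (q + v)) = (- eta < pw (a i) q).
  have [iM|] := boolP (i \in M).
    rewrite v1 // /y; case: ifPn.
      rewrite ltxx lexx ltr_norml => /andP[l1 l2]; split; lra.
    by rewrite -leNgt ler_normr => /orP[l1|l1]; split; lra.
  rewrite inE -leNgt ler_normr pwD => /orP l1.
  by move: (v2 i); rewrite ler_norml => /andP[l2 l3]; case: l1 => l1; split; lra.
exists (q + v); split=> [|i|i]; [|exact: (pwE i).1|exact: (pwE i).2].
rewrite /sq /cen !linearD /= mxE -!addrA lerD2l.
set x := lsubmx q; set z := lsubmx v.
have vt : rsubmx v ord0 ord0 <= mu by rewrite mxE (le_trans (ler_norm _)).
have zmu j : `|z ord0 j| <= mu by rewrite mxE v3.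
have xb : enorm2 x <= `|b| by apply: le_trans qb _; exact: ler_norm.
suff : enorm2 (x + z) <= enorm2 x + mu * (enorm2 x + (2 * d)%:R).
  by move: mu3 vt xb; rewrite /Z; nra.
have -> : enorm2 x + mu * (enorm2 x + (2 * d)%:R) =
    \sum_(j < d) (x ord0 j ^+ 2 + mu * (x ord0 j ^+ 2 + 2)).
  rewrite big_split -mulr_sumr big_split /= sumr_const card_ord natrM.
  by rewrite mulr_natr.
apply: ler_sum => j _; rewrite mxE; move: (zmu j); rewrite ler_norml => /andP[z1 z2].
set s := x _ _; set t := z _ _ in z1 z2 *.
(* [H1] and [H2] give 2 s t <= mu (s^2 + 1); [H3] and [H4] give t^2 <= mu^2 <= mu. *)
have H1 : 0 <= (mu - t) * (s + 1) ^+ 2 by rewrite mulr_ge0 ?sqr_ge0 //; lra.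
have H2 : 0 <= (mu + t) * (s - 1) ^+ 2 by rewrite mulr_ge0 ?sqr_ge0 //; lra.
have H3 : 0 <= (mu - t) * (mu + t) by rewrite mulr_ge0 //; lra.
have H4 : 0 <= mu * (1 - mu) by rewrite mulr_ge0 //; lra.
by rewrite !expr2 in H1 H2 *; lra.
Qed.

Definition inside p : {set 'I_n} := [set i | (0 < pw (a i) p)%R]%SET.
Definition inside_on p : {set 'I_n} := [set i | (0 <= pw (a i) p)%R]%SET.

(* The spheres realising the rhomboid [I, J] have infimal squared radius at
   most r^2. *)
Definition adm (r : R) I J := forall e, 0 < e ->
  exists p, [/\ 0 < sq p, sq p < r ^+ 2 + e, inside p = I & inside_on p = J].

Lemma adm_mono (r r' : R) I J : 0 <= r -> r <= r' -> adm r I J -> adm r' I J.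
Proof.
move=> r0 rr' H e e0; have [p [p0 pr pI pJ]] := H e e0; exists p; split=> //.
by apply: lt_le_trans pr _; nra.
Qed.

(** Each pair that is not admissible has a margin within which no sphere realises it. There are
    finitely many pairs, so one margin serves all. *)
Lemma adm_gap (r : R) : exists2 e : R, 0 < e &
  forall p, 0 < sq p -> sq p < r ^+ 2 + e -> adm r (inside p) (inside_on p).
Proof.
have [||e e0 eP] := @finite_lower_bound R ({set 'I_n} * {set 'I_n})%type (fun K e =>
  forall p, 0 < sq p -> sq p < r ^+ 2 + e -> inside p = K.1 -> inside_on p = K.2 ->
    adm r K.1 K.2).
- by move=> K x y yx Kx p p0 py; apply: Kx => //; lra.
- case=> I J /=; have [IJ|] := pselect (adm r I J); first by exists 1.
  move=> /existsNP[e /not_implyP[e0 /forallNP noe]]; exists e => // p p0 pe pI pJ.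
  by case: (noe p).
by exists e => // p p0 pe; apply: (eP (inside p, inside_on p) p).
Qed.

Lemma inside_sub p : inside p \subset inside_on p.
Proof. by apply/fintype.subsetP => i; rewrite !inE => /ltW. Qed.

Definition cube I J : {set {set 'I_n}} := [set v : {set 'I_n} | (I \subset v) && (v \subset J)]%SET.

Lemma cube_inj I J I' J' : I \subset J -> I' \subset J' -> cube I J = cube I' J' ->
  I = I' /\ J = J'.
Proof.
move=> IJ IJ' /setP cE.
have := cE I; have := cE J; have := cE I'; have := cE J'.
rewrite !inE !subxx IJ IJ' /= => /andP[_ J'J] /andP[II' _] /esym/andP[_ JJ'] /esym/andP[I'I _].
by split; apply/eqP; rewrite finset.eqEsubset ?II' ?JJ'.
Qed.

Lemma comb_rhomboidE c (rho : R) :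
  comb_rhomboid a c rho = cube (inside (sph c (rho ^+ 2))) (inside_on (sph c (rho ^+ 2))).
Proof.
have iE : sph_in a c rho = inside (sph c (rho ^+ 2)).
  by apply/setP => i; rewrite !inE pw_sph subr_gt0.
have -> : inside_on (sph c (rho ^+ 2)) = sph_in a c rho :|: sph_on a c rho.
  by apply/setP => i; rewrite !inE pw_sph subr_ge0 le_eqVlt orbC.
by rewrite -iE.
Qed.

(** The infimum of the radii need not be attained, hence the margins in [adm]. *)
Lemma adm_rhomboidP (r : R) I J : 0 <= r -> I \subset J ->
  (is_rhomboid a (cube I J) /\ r_rhomb a (cube I J) <= r) <-> adm r I J.
Proof.
move=> r0 IJ; set S := [set s : R | exists c, 0 < s /\ comb_rhomboid a c s = cube I J].
have lbS : has_lbound S by exists 0 => s [c [/ltW]].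
split=> [[[c0 [rho0 [rho0_gt0 eqIJ]]] Sr] e e0|H].
  (* The infimum is below sqrt (r^2 + e), hence so is some actual radius; the set of radii is
     nonempty by [is_rhomboid]. *)
  have [||s [c [s0 sc]] sr] := @inf_lt R S (Num.sqrt (r ^+ 2 + e)).
  - by exists rho0, c0.
  - apply: le_lt_trans Sr _; rewrite -{1}(ger0_norm r0) -sqrtr_sqr ltr_sqrt; nra.
  exists (sph c (s ^+ 2)); rewrite sq_sph exprn_gt0 //.
  rewrite comb_rhomboidE in sc; have [<- <-] := cube_inj (inside_sub _) IJ sc.
  split=> //; rewrite -[ltRHS]sqr_sqrtr; last by nra.
  by rewrite ltr_pXn2r ?nnegrE ?sqrtr_ge0 // ltW.
have real_p p : 0 < sq p -> inside p = I -> inside_on p = J -> S (Num.sqrt (sq p)).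
  move=> p0 pI pJ; exists (cen p); rewrite sqrtr_gt0; split => //.
  by rewrite comb_rhomboidE sqr_sqrtr ?sphE ?pI ?pJ // ltW.
split.
  by have [p [p0 _ pI pJ]] := H 1 ltr01; have [c ?] := real_p p p0 pI pJ;
    exists c, (Num.sqrt (sq p)).
(* The margin e^2 is chosen because sqrt (r^2 + e^2) <= r + e. *)
apply/ler_addgt0Pr => e e0; have [|p [p0 pr pI pJ]] := H (e ^+ 2); first exact: exprn_gt0.
apply: le_trans (ge_inf lbS (real_p p p0 pI pJ)) _.
rewrite -[leRHS]ger0_norm ?addr_ge0 ?(ltW e0) // -sqrtr_sqr ler_sqrt ?sqr_ge0 //.
by have := ltW e0; nra.
Qed.
End Cells.

(** * The rhomboid tiling *)

Section Tiling.
Variables (R : realType) (d n : nat) (a : 'I_n -> 'rV[R]_d).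
Implicit Types (p q : 'rV[R]_(d + 1)) (I J : {set 'I_n}) (lam : 'rV[R]_n).

Definition gen (i : 'I_n) : 'rV[R]_(d + 1) := row_mx (a i) (const_mx (- 1)).
Definition emb lam : 'rV[R]_(d + 1) := \sum_i lam ord0 i *: gen i.
Definition box I J : set 'rV[R]_n := [set lam | forall i,
  [/\ 0 <= lam ord0 i <= 1, i \in I -> lam ord0 i = 1 & i \notin J -> lam ord0 i = 0]].

Lemma embed_vertexE (v : {set 'I_n}) : embed_vertex a v = \sum_(i in v) gen i.
Proof.
apply/rowP => l; rewrite summxE /embed_vertex; case: (split_ordP l) => j ->.
  by rewrite row_mxEl summxE; apply: eq_bigr => i _; rewrite row_mxEl.
rewrite row_mxEr mxE; under eq_bigr do rewrite row_mxEr mxE.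
by rewrite sumr_const mulNrn.
Qed.

(** A rhomboid is a zonotope: only the total weight of the vertices containing each site matters in
    a convex combination, and these totals fill the box. *)
Lemma geom_rhomboidE I J x :
  geom_rhomboid a (cube I J) x <-> exists2 lam, box I J lam & x = emb lam.
Proof.
split=> [[w [w0 [w1 ->]]]|[lam lamIJ ->]].
  exists (\row_i \sum_(v in cube I J | i \in v) w v).
    move=> i; rewrite mxE; split.
    - rewrite sumr_ge0 //= -w1 [leRHS](bigID (fun v : {set 'I_n} => i \in v)) /= lerDl.
      by rewrite sumr_ge0.
    - move=> iI; rewrite -w1; apply: eq_bigl => v; rewrite !inE.
      by case: (boolP (I \subset v)) => //= /fintype.subsetP/(_ _ iI) ->; rewrite andbT.
    - move=> iJ; rewrite big_pred0 // => v; rewrite !inE; apply/negP.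
      by move=> /andP[/andP[_ /fintype.subsetP vJ] /vJ]; rewrite (negPf iJ).
  rewrite /emb; under [RHS]eq_bigr do rewrite mxE scaler_suml.
  rewrite (exchange_big_dep (mem (cube I J))) /=; last by move=> i v _ /andP[].
  apply: eq_bigr => v vIJ; rewrite embed_vertexE scaler_sumr.
  by apply: eq_bigl => i; rewrite vIJ.
(* The law of a random vertex containing each site i independently with probability lam_i; its
   marginals are [lam]. *)
pose w (v : {set 'I_n}) := \prod_i (if i \in v then lam ord0 i else 1 - lam ord0 i).
have w0 v : 0 <= w v.
  apply: prodr_ge0 => i _; have [/andP[l0 l1] _ _] := lamIJ i; case: ifP => // _.
  by rewrite subr_ge0.
have wIJ v : v \notin cube I J -> w v = 0.
  move=> vIJ; suff [i iv] : exists i, (if i \in v then lam ord0 i else 1 - lam ord0 i) = 0.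
    by rewrite /w (bigD1 i) //= iv mul0r.
  move: vIJ; rewrite inE negb_and => /orP[] /subsetPn[i i1 i2]; exists i.
    by rewrite (negPf i2); have [_ /(_ i1) -> _] := lamIJ i; rewrite subrr.
  by rewrite i1; have [_ _ /(_ i2)] := lamIJ i.
have sumIJ (T : lmodType R) (F : {set 'I_n} -> T) :
    \sum_(v in cube I J) w v *: F v = \sum_v w v *: F v.
  rewrite [RHS](bigID (mem (cube I J))) /= [X in _ + X]big1 ?addr0 // => v vIJ.
  by rewrite wIJ // scale0r.
have w1 : \sum_v w v = 1.
  have := @bigA_distr R 0 1 *%R +%R 'I_n (fun i => lam ord0 i) (fun i => 1 - lam ord0 i).
  move=> /= <-; by rewrite big1 // => i _; rewrite addrC subrK.
(* Replacing the factor 1 - lam_i by 0 leaves only the subsets containing i in the expanded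
   product. *)
have wlam (i : 'I_n) : \sum_(v : {set 'I_n} | i \in v) w v = lam ord0 i.
  have := @bigA_distr R 0 1 *%R +%R 'I_n (fun i => lam ord0 i)
    (fun j => if j == i then 0 else 1 - lam ord0 j).
  rewrite (bigD1 i) //= eqxx addr0 big1 ?mulr1 => [->|j /negPf ->]; last first.
    by rewrite addrC subrK.
  rewrite big_mkcond; apply: eq_bigr => v _; case: ifPn => [iv|niv]; last first.
    by rewrite (bigD1 i) //= (negPf niv) eqxx mul0r.
  by apply: eq_bigr => j _; case: eqVneq => // ->; rewrite iv.
exists w; split=> //; split.
  have := sumIJ R^o (fun=> 1); rewrite /GRing.scale /= => E.
  rewrite -[RHS]w1 -[RHS](eq_bigr _ (fun v _ => mulr1 (w v))) -E.
  by apply: eq_bigr => v; rewrite mulr1.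
rewrite sumIJ /emb.
have -> : \sum_i lam ord0 i *: gen i = \sum_i \sum_(v : {set 'I_n} | i \in v) w v *: gen i.
  by apply: eq_bigr => i _; rewrite -[in LHS]wlam scaler_suml.
rewrite (exchange_big_dep predT) //=; apply: eq_bigr => v _.
by rewrite embed_vertexE scaler_sumr.
Qed.

Definition tiles (r : R) (k : nat) : set 'rV[R]_n :=
  [set lam | exists I J, [/\ adm a r I J, (k <= #|I|)%N & box I J lam]].

Lemma adm_sub (r : R) I J : adm a r I J -> I \subset J.
Proof. by move=> /(_ 1 ltr01)[p [_ _ <- <-]]; exact: inside_sub. Qed.

(** [I] is the smallest vertex of its rhomboid, so the depth condition is a bound on its
    cardinal. *)
Lemma RhombE (r : R) k x : 0 <= r -> Rhomb a r k x <-> exists2 lam, tiles r k lam & x = emb lam.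
Proof.
move=> r0; split=> [[P [[c [rho [rho0 cP]]] [rP [kP]]]]|[lam [I [J [IJ kI lamIJ]]] ->]].
  move: rP kP; rewrite -cP comb_rhomboidE; set I := inside _ _; set J := inside_on _ _.
  move=> rIJ kIJ /geom_rhomboidE[lam lamIJ ->]; exists lam => //; exists I, J; split=> //.
    apply/adm_rhomboidP; rewrite ?inside_sub //; split=> //; exists c, rho.
    by rewrite comb_rhomboidE.
  by apply: kIJ; rewrite inE subxx inside_sub.
have IJs := adm_sub IJ; have [] := (adm_rhomboidP a r0 IJs).2 IJ.
exists (cube I J); split=> //; split=> //; split; last by apply/geom_rhomboidE; exists lam.
by move=> v; rewrite inE => /andP[/subset_leq_card Iv _]; apply: leq_trans Iv.
Qed.

Definition compat p lam := forall i,
  [/\ 0 <= lam ord0 i <= 1, 0 < pw (a i) p -> lam ord0 i = 1 & pw (a i) p < 0 -> lam ord0 i = 0].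

Lemma box_compat p I J lam : inside a p = I -> inside_on a p = J -> box I J lam <-> compat p lam.
Proof.
move=> <- <-; split=> H i; have [h1 h2 h3] := H i; split=> //.
- by move=> pi; apply: h2; rewrite inE.
- by move=> pi; apply: h3; rewrite inE -ltNge.
- by rewrite inE.
- by rewrite inE -ltNge.
Qed.

(** Carries the pairing with (2 a_i, 1) to the pairing with (a_i, -1): the duality between
    arrangement and tiling. *)
Definition flip (v : 'rV[R]_(d + 1)) : 'rV[R]_(d + 1) := row_mx (2 *: lsubmx v) (- rsubmx v).

Lemma dot_flip i v : dot (gen i) (flip v) = dot (nrm (a i)) v.
Proof.
rewrite -[in RHS](hsubmxK v) /gen /flip /nrm !dot_row dotZr dotZl !dot1 !mxE.
by ring.
Qed.

Definition norm1 (x : 'rV[R]_(d + 1)) := \sum_l `|x ord0 l|.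

Lemma norm1_ge0 x : 0 <= norm1 x. Proof. exact: sumr_ge0. Qed.

Lemma dot_le_norm1 x y : `|dot x y| <= norm1 x * norm1 y.
Proof.
rewrite (le_trans (ler_norm_sum _ _ _)) // mulr_suml; apply: ler_sum => l _.
rewrite normrM ler_wpM2l // /norm1 (bigD1 l) //= lerDl; exact: sumr_ge0.
Qed.

(* Along the two spheres p and p' the differences of the powers and of the
   coordinates have the same sign, so their product, which is controlled by
   emb lam - emb lam', bounds each coordinate whose power varies. *)
Lemma compat_expansive p p' : general_position a -> exists2 C : R, 0 <= C &
  forall lam lam', compat p lam -> compat p' lam' ->
  forall i, `|lam ord0 i - lam' ord0 i| <= C * norm1 (emb lam - emb lam').
Proof.
move=> gpa; pose D i := pw (a i) p - pw (a i) p'.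
(* Here the powers do not vary and the sign argument is void; but these sites are cospherical, so
   they have a dual basis. *)
pose O := [set i | (pw (a i) p == 0) && (pw (a i) p' == 0)]%SET.
have Od : (#|O| <= d.+1)%N.
  by apply: (card_cospherical gpa (p := p)) => i; rewrite inE => /andP[/eqP].
have [V VO] := exists_dual_basis gpa Od.
pose C1 := \sum_i norm1 (flip (p - p')) * `|D i|^-1.
have C1ge0 : 0 <= C1 by rewrite sumr_ge0 // => i _; rewrite mulr_ge0 ?norm1_ge0 ?invr_ge0.
pose C2 := \sum_i (norm1 (flip (V i)) + \sum_j C1 * `|dot (nrm (a j)) (V i)|).
have C2i i : 0 <= norm1 (flip (V i)) + \sum_j C1 * `|dot (nrm (a j)) (V i)|.
  by rewrite addr_ge0 ?norm1_ge0 // sumr_ge0 // => j _; rewrite mulr_ge0.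
exists (C1 + C2) => [|lam lam' lp lp']; first by rewrite addr_ge0 // sumr_ge0.
pose del i := lam ord0 i - lam' ord0 i; set N := norm1 _.
have N0 : 0 <= N by exact: norm1_ge0.
have dotX v : \sum_i del i * dot (nrm (a i)) v = dot (emb lam - emb lam') (flip v).
  rewrite /emb -sumrB dot_suml; apply: eq_bigr => i _.
  by rewrite -scalerBl dotZl dot_flip.
(* If the power is larger at [p] than at [p'], then either the site is inside [p] and its
   coefficient there is 1, or it is outside [p'] and its coefficient there is 0. *)
have T0 i : 0 <= del i * D i.
  have [/andP[l0 l1] l2 l3] := lp i; have [/andP[l0' l1'] l2' l3'] := lp' i.
  rewrite /del /D; have [pp'|p'p|->] := ltgtP (pw (a i) p) (pw (a i) p'); last first.
  - by rewrite subrr mulr0.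
  - apply: mulr_ge0; rewrite subr_ge0; last exact: ltW.
    by case: (ltP 0 (pw (a i) p)) => h; [rewrite l2|rewrite l3' //; exact: lt_le_trans p'p h].
  - apply: mulr_le0; rewrite subr_le0; last exact: ltW.
    by case: (ltP 0 (pw (a i) p')) => h; [rewrite l2'|rewrite l3 //; exact: lt_le_trans pp' h].
have T1 i : del i * D i <= N * norm1 (flip (p - p')).
  rewrite (le_trans _ (le_trans (ler_norm _) (dot_le_norm1 _ _))) //.
  rewrite -dotX (bigD1 i) //= /D.
  have DE j : pw (a j) p - pw (a j) p' = dot (nrm (a j)) (p - p').
    by rewrite /pw dotBr; ring.
  by rewrite DE lerDl sumr_ge0 // => j _; rewrite -DE T0.
have out i : i \notin O -> `|del i| <= C1 * N.
  (* With equal nonzero powers the site is strictly on the same side of both spheres, so the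
     coefficients agree. *)
  move=> iO; have [Di0|Di] := eqVneq (D i) 0.
    suff -> : del i = 0 by rewrite normr0 mulr_ge0.
    have [_ l2 l3] := lp i; have [_ l2' l3'] := lp' i.
    move/eqP: Di0; rewrite subr_eq0 => /eqP Di0.
    rewrite /del; move: iO; rewrite inE -Di0 andbb.
    case: (ltgtP (pw (a i) p) 0) => // h _.
      by rewrite l3 // l3' -?Di0 // subrr.
    by rewrite l2 // l2' -?Di0 // subrr.
  rewrite /C1 mulr_suml (bigD1 i) //= ler_wpDr ?sumr_ge0 // => [j _|].
    by rewrite !mulr_ge0 ?norm1_ge0 ?invr_ge0.
  rewrite mulrAC ler_pdivlMr ?normr_gt0 // -normrM ger0_norm //.
  by rewrite [leRHS]mulrC T1.
move=> i; rewrite -/(del i) mulrDl.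
have [iO|iO] := boolP (i \in O); last first.
  by rewrite (le_trans (out i iO)) // lerDl mulr_ge0 // sumr_ge0.
rewrite (le_trans (y := C2 * N)) ?lerDr ?mulr_ge0 //.
rewrite /C2 mulr_suml (bigD1 i) //= ler_wpDr ?sumr_ge0 // => [j _|]; first by rewrite mulr_ge0.
(* Pairing with [V i] isolates coordinate i among those in [O]; the coordinates outside [O] are
   already bounded. *)
have delE : del i = dot (emb lam - emb lam') (flip (V i)) -
    \sum_(j | j \notin O) del j * dot (nrm (a j)) (V i).
  rewrite -dotX (bigID (mem O)) /= addrK (bigD1 i) //= VO // eqxx mulr1 big1 ?addr0 //.
  by move=> j /andP[jO ji]; rewrite VO // (negPf ji) mulr0.
rewrite delE (le_trans (ler_normB _ _)) // mulrDl lerD //.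
  by rewrite mulrC dot_le_norm1.
rewrite (le_trans (ler_norm_sum _ _ _)) // mulr_suml [leRHS](bigID (fun j => j \notin O)) /=.
rewrite ler_wpDr ?sumr_ge0 // => [j _|]; first by rewrite !mulr_ge0.
by apply: ler_sum => j jO; rewrite normrM mulrAC ler_wpM2r ?out.
Qed.

(** One constant for all pairs of tiles. It makes [emb] injective on the tiling, with continuous
    inverse. *)
Lemma tiles_expansive (r : R) (k : nat) : general_position a -> exists2 C : R, 0 <= C &
  forall lam lam', tiles r k lam -> tiles r k lam' ->
  forall i, `|lam ord0 i - lam' ord0 i| <= C * norm1 (emb lam - emb lam').
Proof.
move=> gpa.
have [||C C0 CP] := @finite_upper_bound R
    ({set 'I_n} * {set 'I_n} * ({set 'I_n} * {set 'I_n}))%type (fun K C =>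
  adm a r K.1.1 K.1.2 -> adm a r K.2.1 K.2.2 -> forall lam lam',
  box K.1.1 K.1.2 lam -> box K.2.1 K.2.2 lam' ->
  forall i, `|lam ord0 i - lam' ord0 i| <= C * norm1 (emb lam - emb lam')).
- move=> K x y xy H K1 K2 lam lam' l l' i; apply: le_trans (H K1 K2 _ _ l l' i) _.
  by rewrite ler_wpM2r // norm1_ge0.
- case=> [[I J] [I' J']] /=; have [IJ|nIJ] := pselect (adm a r I J); last by exists 0.
  have [IJ'|nIJ'] := pselect (adm a r I' J'); last by exists 0.
  have [p [_ _ pI pJ]] := IJ 1 ltr01; have [p' [_ _ pI' pJ']] := IJ' 1 ltr01.
  have [C _ CP] := compat_expansive p p' gpa; exists C => _ _ lam lam' l l'.
  by apply: CP; [exact/(box_compat _ pI pJ)|exact/(box_compat _ pI' pJ')].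
exists C => // lam lam' [I [J [IJ _ l]]] [I' [J' [IJ' _ l']]].
exact: (CP (I, J, (I', J'))).
Qed.

End Tiling.

(** * Continuity and homotopies *)

Section Continuity.
Variables (R : realType) (T : topologicalType).

Lemma continuous_add (V : normedModType R) (f g : T -> V) :
  continuous f -> continuous g -> continuous (fun x => f x + g x).
Proof. by move=> cf cg x; apply: continuousD; [exact: cf|exact: cg]. Qed.

Lemma continuous_scale (V : normedModType R) (s : T -> R) (f : T -> V) :
  continuous s -> continuous f -> continuous (fun x => s x *: f x).
Proof. by move=> cs cf x; apply: continuousZ; [exact: cs|exact: cf]. Qed.

Lemma continuous_mul (f g : T -> R) :
  continuous f -> continuous g -> continuous (fun x => f x * g x).
Proof. by move=> cf cg x; apply: continuousM; [exact: cf|exact: cg]. Qed.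

Lemma continuous_sub (f g : T -> R) :
  continuous f -> continuous g -> continuous (fun x => f x - g x).
Proof. by move=> cf cg x; apply: continuousB; [exact: cf|exact: cg]. Qed.

Lemma continuous_maxr (f g : T -> R) :
  continuous f -> continuous g -> continuous (fun x => Num.max (f x) (g x)).
Proof. by move=> cf cg x; apply: continuous_max; [exact: cf|exact: cg]. Qed.

Lemma continuous_minr (f g : T -> R) :
  continuous f -> continuous g -> continuous (fun x => Num.min (f x) (g x)).
Proof. by move=> cf cg x; apply: continuous_min; [exact: cf|exact: cg]. Qed.

Lemma continuous_sumr (V : normedModType R) (K : finType) (P : pred K) (F : K -> T -> V) :
  (forall k, continuous (F k)) -> continuous (fun x => \sum_(k | P k) F k x).
Proof.
move=> cF; rewrite (_ : (fun x => _) = \sum_(k | P k) F k).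
  by elim/big_ind: _ => [|f g cf cg|k _]; [exact: cst_continuous|exact: continuous_add|].
by apply/funext => x; rewrite fct_sumE.
Qed.

Lemma continuous_prodr (K : finType) (F : K -> T -> R) :
  (forall k, continuous (F k)) -> continuous (fun x => \prod_k F k x).
Proof.
move=> cF; suff: forall s : seq K, continuous (fun x => \prod_(k <- s) F k x) by apply.
elim=> [|k s IHs].
  by rewrite (_ : (fun x => _) = cst 1); [exact: cst_continuous|apply/funext => x; rewrite big_nil].
rewrite (_ : (fun x => _) = fun x => F k x * \prod_(j <- s) F j x).
  exact: continuous_mul.
by apply/funext => x; rewrite big_cons.
Qed.

Lemma continuous_row (m : nat) (F : 'I_m -> T -> R) :
  (forall i, continuous (F i)) -> continuous (fun x => \row_i F i x).
Proof.
move=> cF; rewrite (_ : (fun x => _) = fun x => \sum_i F i x *: delta_mx (ord0 : 'I_1) i).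
  by apply: continuous_sumr => i; apply: continuous_scale => //; exact: cst_continuous.
by apply/funext => x; rewrite [LHS]row_sum_delta; apply: eq_bigr => i _; rewrite mxE.
Qed.

Lemma continuous_entry (m : nat) (f : T -> 'rV[R]_m) (i : 'I_m) :
  continuous f -> continuous (fun x => f x ord0 i).
Proof.
by move=> cf x; apply: (continuous_comp (g := fun M : 'rV[R]_m => M ord0 i)); 
  [exact: cf|exact: coord_continuous].
Qed.

Lemma continuous_dot (m : nat) (y : 'rV[R]_m) (f : T -> 'rV[R]_m) :
  continuous f -> continuous (fun x => dot y (f x)).
Proof.
move=> cf; apply: continuous_sumr => l; apply: continuous_mul; first exact: cst_continuous.
exact: continuous_entry.
Qed.

Lemma continuous_enorm2B (m : nat) (y : 'rV[R]_m) (f : T -> 'rV[R]_m) :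
  continuous f -> continuous (fun x => enorm2 (f x - y)).
Proof.
move=> cf; apply: continuous_sumr => l.
rewrite (_ : (fun x => _) = fun x => (f x ord0 l - y ord0 l) * (f x ord0 l - y ord0 l)).
  by apply: continuous_mul; apply: continuous_sub;
    [exact: continuous_entry|exact: cst_continuous|exact: continuous_entry|exact: cst_continuous].
by apply/funext => x; rewrite !mxE.
Qed.

Lemma continuous_pair (U V : topologicalType) (f : T -> U) (g : T -> V) :
  continuous f -> continuous g -> continuous (fun x => (f x, g x)).
Proof. by move=> cf cg x; apply: cvg_pair; [exact: cf|exact: cg]. Qed.

End Continuity.

Lemma continuous_compose (T U V : topologicalType) (f : T -> U) (g : U -> V) :
  continuous f -> continuous g -> continuous (fun x => g (f x)).
Proof. by move=> cf cg x; apply: (continuous_comp (g := g)); [exact: cf|exact: cg]. Qed.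

Lemma continuous_fst (T U : topologicalType) : continuous (fun x : T * U => x.1).
Proof. by move=> x; exact: cvg_fst. Qed.

Lemma continuous_snd (T U : topologicalType) : continuous (fun x : T * U => x.2).
Proof. by move=> x; exact: cvg_snd. Qed.

Section Homotopy.
Variables (R : realType) (T : topologicalType) (U : normedModType R).
Implicit Types (X : set T) (Y : set U) (f g h : T -> U).

(* Continuity on all of T * R spares compositions of maps within subspaces. *)
Definition ghomotopic X Y f g := exists H : T * R -> U,
  [/\ continuous H, forall x t, X x -> 0 <= t <= 1 -> Y (H (x, t))
    & forall x, X x -> H (x, 0) = f x /\ H (x, 1) = g x].

Lemma ghomotopic_homotopic X Y f g : ghomotopic X Y f g -> @homotopic R T U X Y f g.
Proof. by move=> [H [cH HY Hfg]]; exists H; split=> //; exact: continuous_subspaceT. Qed.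

(** Concatenation in one formula: at every time one of the two homotopies stands at [g], which is
    subtracted, so nothing is pasted along closed halves. *)
Lemma ghomotopic_trans X Y f g h : continuous g ->
  ghomotopic X Y f g -> ghomotopic X Y g h -> ghomotopic X Y f h.
Proof.
move=> cg [H [cH HY Hfg]] [K [cK KY Kgh]].
pose s (z : T * R) : R := Num.min (2 * z.2) 1.
pose t (z : T * R) : R := Num.max (2 * z.2 - 1) 0.
exists (fun z => H (z.1, s z) + K (z.1, t z) + (- 1) *: g z.1).
have c2 : continuous (fun z : T * R => 2 * z.2).
  by apply: continuous_mul; [exact: cst_continuous|exact: continuous_snd].
have cs : continuous s by apply: continuous_minr => //; exact: cst_continuous.
have ct : continuous t.
  apply: continuous_maxr; last exact: cst_continuous.
  by apply: continuous_sub => //; exact: cst_continuous.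
split.
- apply: continuous_add; last first.
    apply: continuous_scale; first exact: cst_continuous.
    exact: continuous_compose (@continuous_fst _ _) cg.
  apply: continuous_add; [apply: continuous_compose _ cH|apply: continuous_compose _ cK].
    by apply: continuous_pair => //; exact: continuous_fst.
  by apply: continuous_pair => //; exact: continuous_fst.
- move=> x u Xx /andP[u0 u1]; rewrite /s /t /= scaleN1r.
  have [_ H1] := Hfg x Xx; have [K0 _] := Kgh x Xx.
  have [u2|u2] := leP u (1 / 2).
    rewrite min_l ?max_r; [|lra..].
    by rewrite K0 addrK; apply: HY => //; apply/andP; split; lra.
  rewrite min_r ?max_l; [|lra..].
  by rewrite H1 addrC addKr; apply: KY => //; apply/andP; split; lra.
- move=> x Xx; have [H0 H1] := Hfg x Xx; have [K0 K1] := Kgh x Xx.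
  rewrite /s /t /= !scaleN1r mulr0 sub0r mulr1; split.
    by rewrite min_l ?max_r; [|lra..]; rewrite H0 K0 addrK.
  rewrite min_r ?max_l; [|lra..].
  by rewrite H1 addrC addKr (_ : 2 - 1 = 1 :> R) ?K1 //; ring.
Qed.

Lemma ghomotopic_lerp X Y f g : continuous f -> continuous g ->
  (forall x t, X x -> 0 <= t <= 1 -> Y ((1 - t) *: f x + t *: g x)) -> ghomotopic X Y f g.
Proof.
move=> cf cg Yfg; exists (fun z => (1 - z.2) *: f z.1 + z.2 *: g z.1); split=> //.
- apply: continuous_add; apply: continuous_scale.
  + by apply: continuous_sub; [exact: cst_continuous|exact: continuous_snd].
  + exact: continuous_compose (@continuous_fst _ _) cf.
  + exact: continuous_snd.
  + exact: continuous_compose (@continuous_fst _ _) cg.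
- by move=> x Xx /=; rewrite subr0 subrr !scale1r !scale0r addr0 add0r.
Qed.

Lemma ghomotopic_eq X Y f f' g : {in X, f =1 f'} -> ghomotopic X Y f g -> ghomotopic X Y f' g.
Proof.
move=> ff' [H [cH HY Hfg]]; exists H; split=> // x Xx.
by have [H0 H1] := Hfg x Xx; rewrite H0 ff' ?inE.
Qed.

End Homotopy.

(** * A common point of the balls around the sites of a tile *)

Section CommonPoint.
Variables (R : realType) (d n : nat) (a : 'I_n -> 'rV[R]_d).

(** Centres of spheres realising the pair with small margins make [F] arbitrarily small on a compact
    box, where [F] attains its minimum. *)
Lemma adm_ball (r : R) (I J : {set 'I_n}) : 0 <= r -> adm a r I J ->
  exists c, forall j, j \in J -> enorm2 (c - a j) <= r ^+ 2.
Proof.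
move=> r0 admIJ; have [->|[j0 j0J]] := set_0Vmem J.
  by exists 0 => j; rewrite inE.
pose F c := \sum_(j in J) Num.max 0 (enorm2 (c - a j) - r ^+ 2).
have cF : continuous F.
  apply: continuous_sumr => j; apply: continuous_maxr; first exact: cst_continuous.
  apply: continuous_sub; last exact: cst_continuous.
  by apply: continuous_enorm2B => x; exact: cvg_id.
(* Margins are capped at 1, and r^2 + 1 <= (r + 1)^2 puts all the centres used into this box. *)
pose A := [set c : 'rV[R]_d | forall l,
  `[a j0 ord0 l - (r + 1), a j0 ord0 l + (r + 1)]%classic (c ord0 l)].
have cA : compact A.
  apply: (@rV_compact _ _ (fun l =>
    `[a j0 ord0 l - (r + 1), a j0 ord0 l + (r + 1)]%classic)) => l.
  exact: segment_compact.
have approx e : 0 < e -> exists2 c, A c & F c <= #|J|%:R * e.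
  move=> e0; have [|p [p0 pe _ pJ]] := admIJ (Num.min e 1); first by rewrite lt_min e0 ltr01.
  have pj j : j \in J -> enorm2 (cen p - a j) <= r ^+ 2 + Num.min e 1.
    rewrite -pJ inE pwE subr_ge0 enorm2Bsym => /le_trans; apply; exact: ltW.
  exists (cen p).
    move=> l; rewrite /= in_itv /= -ler_distl -[leRHS]ger0_norm ?addr_ge0 //.
    rewrite -ler_sqr ?nnegrE // !real_normK ?num_real //.
    apply: (@le_trans _ _ (enorm2 (cen p - a j0))).
      by rewrite /enorm2 (bigD1 l) //= !mxE lerDl sumr_ge0 // => i _; rewrite sqr_ge0.
    apply: le_trans (pj _ j0J) _; have : Num.min e 1 <= 1 by rewrite ge_min lexx orbT.
    by nra.
  rewrite -[#|J|%:R]mulr1 -mulrA mulr_natl mul1r -sumr_const ler_sum // => j jJ.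
  rewrite ge_max ltW //= lerBlDl; apply: le_trans (pj j jJ) _.
  by rewrite lerD2l ge_min lexx.
have [||c _ cmin] := EVT_min_rV _ cA (f := F); first by have [c Ac _] := approx 1 ltr01; exists c.
  exact: continuous_subspaceT.
have Fc0 : F c <= 0.
  apply/ler_addgt0Pr => e e0; rewrite add0r.
  have J0 : 0 < #|J|%:R :> R by rewrite ltr0n; apply/card_gt0P; exists j0.
  have [c' Ac' Fc'] := approx (e / #|J|%:R) (divr_gt0 e0 J0).
  apply: le_trans (cmin c' _) _; first by rewrite inE.
  by apply: le_trans Fc' _; rewrite mulrCA divff ?mulr1 ?gt_eqF.
exists c => j jJ; rewrite -subr_le0 (le_trans _ Fc0) // /F (bigD1 j) //=.
rewrite ler_wpDr ?le_max ?lexx ?orbT //; apply: sumr_ge0 => i _.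
by rewrite le_max lexx.
Qed.

End CommonPoint.

(** * Partition of unity on the tiling *)

Notation face n := ({set 'I_n} * {set 'I_n})%type.

Section Bridge.
Variables (R : realType) (d n : nat) (a : 'I_n -> 'rV[R]_d).
Implicit Types (p q : 'rV[R]_(d + 1)) (I J M : {set 'I_n}) (lam mu : 'rV[R]_n).

Definition clamp (x : R) : R := Num.max 0 (Num.min x 1).

Lemma clamp01 x : 0 <= clamp x <= 1.
Proof. by rewrite /clamp le_max lexx ge_max ler01 ge_min lexx orbT. Qed.

Lemma clamp_ge1 x : 1 <= x -> clamp x = 1.
Proof. by move=> x1; rewrite /clamp min_r // max_r // ler01. Qed.

Lemma clamp_le0 x : x <= 0 -> clamp x = 0.
Proof. by move=> x0; rewrite /clamp max_l // ge_min x0. Qed.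

Lemma continuous_clamp (T : topologicalType) (f : T -> R) :
  continuous f -> continuous (fun x => clamp (f x)).
Proof.
move=> cf; apply: continuous_maxr; first exact: cst_continuous.
by apply: continuous_minr => //; exact: cst_continuous.
Qed.

Lemma box_lerp I J lam mu (t : R) : 0 <= t <= 1 -> box I J lam -> box I J mu ->
  box I J ((1 - t) *: lam + t *: mu).
Proof.
move=> /andP[t0 t1] l m i; rewrite !mxE.
have [/andP[l0 l1] l2 l3] := l i; have [/andP[m0 m1] m2 m3] := m i; split.
- by apply/andP; split; nra.
- by move=> iI; rewrite l2 // m2 //; ring.
- by move=> iJ; rewrite l3 // m3 //; ring.
Qed.

(** Stretches [1/4, 3/4] onto [0, 1]; the thresholds are those of [weight]. *)
Definition sharpen lam : 'rV[R]_n := \row_i clamp (2 * lam ord0 i - 1 / 2).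

Lemma sharpen1 lam i : 3 / 4 <= lam ord0 i -> sharpen lam ord0 i = 1.
Proof. by move=> h; rewrite mxE clamp_ge1 //; lra. Qed.

Lemma sharpen0 lam i : lam ord0 i <= 1 / 4 -> sharpen lam ord0 i = 0.
Proof. by move=> h; rewrite mxE clamp_le0 //; lra. Qed.

Lemma sharpen_box I J lam : box I J lam -> box I J (sharpen lam).
Proof.
move=> l i; have [_ l2 l3] := l i; split.
- by rewrite mxE clamp01.
- by move=> iI; rewrite sharpen1 // l2 //; lra.
- by move=> iJ; rewrite sharpen0 // l3 //; lra.
Qed.

Lemma continuous_sharpen : continuous sharpen.
Proof.
apply: continuous_row => i; apply: continuous_clamp.
apply: continuous_sub; last exact: cst_continuous.
apply: continuous_mul; first exact: cst_continuous.
exact: coord_continuous.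
Qed.

(** A linear ramp in the power, 0 up to [- eta] and 1 from [eta] on. *)
Definition tile_of (eta : R) (g : 'I_n -> R) : 'rV[R]_n := \row_i clamp ((1 + g i / eta) / 2).

Lemma tile_of1 eta g i : 0 < eta -> eta <= g i -> tile_of eta g ord0 i = 1.
Proof.
move=> eta0 h; rewrite mxE clamp_ge1 //.
have : 1 <= g i / eta by rewrite ler_pdivlMr // mul1r.
by lra.
Qed.

Lemma tile_of0 eta g i : 0 < eta -> g i <= - eta -> tile_of eta g ord0 i = 0.
Proof.
move=> eta0 h; rewrite mxE clamp_le0 //.
have : g i / eta <= - 1 by rewrite ler_pdivrMr // mulN1r.
by lra.
Qed.

Lemma tile_of_box eta g : 0 < eta ->
  box [set i | (eta <= g i)%R]%SET [set i | (- eta < g i)%R]%SET (tile_of eta g).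
Proof.
move=> eta0 i; split; first by rewrite mxE clamp01.
  by rewrite inE => /tile_of1; apply.
by rewrite inE -leNgt => /tile_of0; apply.
Qed.

Lemma continuous_tile_of (T : topologicalType) eta (g : T -> 'I_n -> R) :
  (forall i, continuous (fun x => g x i)) -> continuous (fun x => tile_of eta (g x)).
Proof.
move=> cg; apply: continuous_row => i; apply: continuous_clamp.
apply: continuous_mul; last exact: cst_continuous.
apply: continuous_add; first exact: cst_continuous.
by apply: continuous_mul; last exact: cst_continuous.
Qed.

Section Weights.
Variables (r : R) (k : nat).

Definition valid (K : face n) := `[< adm a r K.1 K.2 /\ (k <= #|K.1|)%N >].

(* The weight of the tile [K] vanishes unless [lam] is close to [K], so that
   [sharpen lam] belongs to [K]. *)
Definition weight (K : face n) lam : R := if valid K then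
  \prod_i ((if i \in K.1 then Num.max 0 (lam ord0 i - 3 / 4) else 1) *
           (if i \in K.2 then 1 else Num.max 0 (1 / 4 - lam ord0 i))) else 0.

(** At a point of the tile itself each of the [n] factors of its weight is at least 1/4. *)
Definition wmin : R := (1 / 4) ^+ n.
(** The maximum with [wmin] changes nothing on the tiling and keeps the quotient continuous
    everywhere. *)
Definition nweight (K : face n) lam : R := weight K lam / Num.max (\sum_K' weight K' lam) wmin.

Lemma wmin_gt0 : 0 < wmin. Proof. by rewrite exprn_gt0 //; lra. Qed.

Lemma weight_ge0 K lam : 0 <= weight K lam.
Proof.
rewrite /weight; case: ifP => // _; apply: prodr_ge0 => i _.
by apply: mulr_ge0; case: ifP => // _; rewrite ?le_max ?lexx.
Qed.

Lemma weight_neq0 K lam : weight K lam != 0 ->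
  [/\ valid K, forall i, i \in K.1 -> 3 / 4 < lam ord0 i
    & forall i, i \notin K.2 -> lam ord0 i < 1 / 4].
Proof.
rewrite /weight; case: ifP => [vK|_]; last by rewrite eqxx.
move=> /prodf_neq0 H; split=> // i iK; have := H i isT; rewrite mulf_eq0 negb_or => /andP[].
  rewrite iK => h _; rewrite -subr_gt0 ltNge; apply: contra h => h; by rewrite max_l.
rewrite (negPf iK) => _ h; rewrite -subr_gt0 ltNge; apply: contra h => h; by rewrite max_l.
Qed.

Lemma weight_le1 K lam : (forall i, 0 <= lam ord0 i <= 1) -> weight K lam <= 1.
Proof.
move=> l01; rewrite /weight; case: ifP => // _.
have := @ler_prod R _ (index_enum 'I_n) predT
  (fun i => (if i \in K.1 then Num.max 0 (lam ord0 i - 3 / 4) else 1) *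
            (if i \in K.2 then 1 else Num.max 0 (1 / 4 - lam ord0 i))) (fun=> 1).
rewrite [leRHS]big1 //; apply => i _; have /andP[l0 l1] := l01 i.
have fac (b : bool) (x : R) : x <= 1 -> 0 <= (if b then Num.max 0 x else 1) <= 1.
  by case: b => x1; rewrite ?lexx ?ler01 // le_max lexx ge_max ler01.
have l34 : lam ord0 i - 3 / 4 <= 1 by lra.
have l14 : 1 / 4 - lam ord0 i <= 1 by lra.
have /andP[f0 f1] := fac (i \in K.1) _ l34.
have /andP[g0 g1] := fac (i \notin K.2) _ l14.
by move: g0 g1; rewrite if_neg => g0 g1; rewrite mulr_ge0 // mulr_ile1.
Qed.

Lemma weight_box K lam : valid K -> box K.1 K.2 lam -> wmin <= weight K lam.
Proof.
move=> vK l; rewrite /weight vK /wmin -[X in _ ^+ X]card_ord -prodr_const.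
have KK : K.1 \subset K.2 by move: vK => /asboolP[/adm_sub].
apply: ler_prod => i _; have [/andP[l0 l1] l2 l3] := l i.
apply/andP; split; first by lra.
case: ifPn => [iI|iI].
  by rewrite (fintype.subsetP KK _ iI) mulr1 l2 // le_max; apply/orP; right; lra.
rewrite [leRHS]mul1r; case: ifPn => [_|iJ]; first by lra.
by rewrite (l3 iJ) le_max; apply/orP; right; lra.
Qed.

Lemma nweight_ge0 K lam : 0 <= nweight K lam.
Proof.
by rewrite mulr_ge0 ?weight_ge0 // invr_ge0 le_max (ltW wmin_gt0) orbT.
Qed.

Lemma nweight_neq0 K lam : nweight K lam != 0 ->
  [/\ valid K, forall i, i \in K.1 -> 3 / 4 < lam ord0 i
    & forall i, i \notin K.2 -> lam ord0 i < 1 / 4].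
Proof. by rewrite mulf_eq0 negb_or => /andP[/weight_neq0]. Qed.

Lemma tilesP lam : tiles a r k lam <-> exists2 K, valid K & box K.1 K.2 lam.
Proof.
split=> [[I [J [IJ kI l]]]|[[I J] /asboolP[/= IJ kI] l]].
  by exists (I, J) => //; apply/asboolP.
by exists I, J.
Qed.

Lemma tiles_weight lam : tiles a r k lam -> wmin <= \sum_K weight K lam.
Proof.
move=> /tilesP[K vK l]; rewrite (bigD1 K) //= ler_wpDr ?weight_box //.
by apply: sumr_ge0 => K' _; exact: weight_ge0.
Qed.

Lemma nweight_sum lam : tiles a r k lam -> \sum_K nweight K lam = 1.
Proof.
move=> /tiles_weight wl; rewrite -mulr_suml max_l // divff // gt_eqF //.
exact: lt_le_trans wmin_gt0 wl.
Qed.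

(** The total weight is at most the number of faces, as no weight exceeds 1 here. The bound is the
    factor in [bd_margin]. *)
Lemma nweight_box K lam : valid K -> box K.1 K.2 lam -> wmin / #|{: face n}|%:R <= nweight K lam.
Proof.
move=> vK l; have lt : tiles a r k lam by apply/tilesP; exists K.
have wl := tiles_weight lt; have w0 := lt_le_trans wmin_gt0 wl.
rewrite /nweight max_l //; apply: ler_pM.
- exact: ltW wmin_gt0.
- by rewrite invr_ge0.
- exact: weight_box.
rewrite lef_pV2 ?posrE //; last first.
  by rewrite ltr0n; apply/card_gt0P; exists K.
rewrite -sumr_const; apply: ler_sum => K' _; apply: weight_le1 => i.
by have [] := l i.
Qed.

Lemma continuous_nweight K : continuous (nweight K).
Proof.
have cw K' : continuous (weight K').
  rewrite /weight; case: (valid K'); last exact: cst_continuous.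
  apply: continuous_prodr => i; apply: continuous_mul; case: (i \in _);
    do ?exact: cst_continuous; apply: continuous_maxr; do ?exact: cst_continuous.
    by apply: continuous_sub; [exact: coord_continuous|exact: cst_continuous].
  by apply: continuous_sub; [exact: cst_continuous|exact: coord_continuous].
have cm : continuous (fun lam => Num.max (\sum_K' weight K' lam) wmin).
  by apply: continuous_maxr; [exact: continuous_sumr|exact: cst_continuous].
apply: continuous_mul => // lam; apply: (cvgV _ (cm lam)).
by rewrite gt_eqF // lt_max wmin_gt0 orbT.
Qed.

Definition blend (m : nat) (F : face n -> 'rV[R]_m) lam := \sum_K nweight K lam *: F K.

Lemma continuous_blend m (F : face n -> 'rV[R]_m) : continuous (blend F).
Proof.
apply: continuous_sumr => K; apply: continuous_scale; first exact: continuous_nweight.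
exact: cst_continuous.
Qed.

End Weights.

End Bridge.

(** * The two equivalences *)

Section Equivalences.
Variables (R : realType) (d n : nat) (a : 'I_n -> 'rV[R]_d).
Implicit Types (p q : 'rV[R]_(d + 1)) (I J M : {set 'I_n}) (lam mu : 'rV[R]_n).

Lemma ball_lerp (x y z : 'rV[R]_d) (s t : R) : 0 <= t <= 1 ->
  enorm2 (x - z) <= s -> enorm2 (y - z) <= s -> enorm2 ((1 - t) *: x + t *: y - z) <= s.
Proof.
move=> /andP[t0 t1] xs ys.
have := @ball_conv R d bool (fun b => if b then 1 - t else t) (fun b => if b then x else y) z s.
rewrite !big_bool /=; apply; first by case; rewrite ?subr_ge0.
  by rewrite subrK.
by case.
Qed.

Definition near_sites (r : R) (x : 'rV[R]_d) : {set 'I_n} :=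
  [set i | (enorm2 (x - a i) <= r ^+ 2)%R]%SET.

(* In Cov the cardinal is taken of a classical set, not of a finite set. *)
Lemma CovE (r : R) k x : Cov a r k x = (k <= #|near_sites r x|)%N.
Proof.
rewrite /Cov /=; congr (is_true (k <= _)%N); apply: eq_card => i; rewrite [RHS]inE.
by apply/idP/idP => [/set_mem|h]; last exact/mem_set.
Qed.

Definition bridge (r : R) (k : nat) : set ('rV[R]_n * 'rV[R]_d) :=
  [set x | tiles a r k x.1 /\ forall i, x.1 ord0 i = 1 -> enorm2 (x.2 - a i) <= r ^+ 2].

(* [P K] is a sphere realising the tile [K], [c K] is the centre of a ball of
   radius r containing the sites of [K]; [eta] is the distance at which a site
   starts to be considered as lying on a sphere. *)
Record bridge_data (r e eta : R) (P : face n -> 'rV[R]_(d + 1)) (c : face n -> 'rV[R]_d) : Prop :=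
  BridgeData {
    bd_eta : 0 < eta <= e;
    bd_adm : forall q i, sq q <= r ^+ 2 + e -> eta <= pw (a i) q ->
      adm a r [set i | (eta <= pw (a i) q)%R]%SET [set i | (- eta < pw (a i) q)%R]%SET;
    bd_sq : forall K, adm a r K.1 K.2 -> sq (P K) <= r ^+ 2 + e;
    bd_inside : forall K, adm a r K.1 K.2 -> inside a (P K) = K.1;
    bd_inside_on : forall K, adm a r K.1 K.2 -> inside_on a (P K) = K.2;
    bd_margin : forall K i, adm a r K.1 K.2 -> i \in K.1 ->
      eta <= wmin R n / #|{: face n}|%:R * pw (a i) (P K);
    bd_ball : forall K j, adm a r K.1 K.2 -> j \in K.2 -> enorm2 (c K - a j) <= r ^+ 2 }.

(** Order of choice: the gap [e], the spheres [P], the least power [m] of their inner sites, and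
    last the layer [eta], small against all of these. *)
Lemma exists_bridge_data (r : R) : general_position a -> 0 <= r ->
  exists e eta P c, bridge_data r e eta P c.
Proof.
move=> gpa r0; have [e' e'0 gap] := adm_gap a r.
(* Snapping a sphere of squared radius at most r^2 + e adds at most another [e], which stays
   strictly below r^2 + e'. *)
pose e := e' / 3; have e0 : 0 < e by rewrite divr_gt0.
have e'E : e' = e + e + e by rewrite /e; lra.
have /choice[P HP] : forall K : face n, exists p, adm a r K.1 K.2 ->
    [/\ sq p <= r ^+ 2 + e, inside a p = K.1 & inside_on a p = K.2].
  move=> K; have [admK|] := pselect (adm a r K.1 K.2); last by exists 0.
  by have [p [_ pe pI pJ]] := admK e e0; exists p => _; split=> //; exact: ltW.
have /choice[c Hc] : forall K : face n, exists c, adm a r K.1 K.2 ->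
    forall j, j \in K.2 -> enorm2 (c - a j) <= r ^+ 2.
  move=> K; have [admK|] := pselect (adm a r K.1 K.2); last by exists 0.
  by have [c cK] := adm_ball r0 admK; exists c.
have [||m m0 Pm] := @finite_lower_bound R (face n * 'I_n)%type (fun K m =>
  adm a r K.1.1 K.1.2 -> K.2 \in K.1.1 -> m <= pw (a K.2) (P K.1)).
- by move=> K x y yx H h1 h2; apply: le_trans yx (H h1 h2).
- case=> K i /=; have [h|h] := leP (pw (a i) (P K)) 0; last by exists (pw (a i) (P K)).
  exists 1 => // /HP[_ <- _]; by rewrite inE ltNge h.
pose N : R := wmin R n / #|{: face n}|%:R.
have N0 : 0 < N.
  rewrite divr_gt0 ?wmin_gt0 // ltr0n; apply/card_gt0P; by exists (finset.set0, finset.set0).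
(* Bounds |cen q|^2 <= 2 |a_i - cen q|^2 + 2 |a_i|^2 for every sphere [q] of squared radius at most
   r^2 + e around some site. *)
pose b := \sum_i (2 * (r ^+ 2 + e) + 2 * enorm2 (a i)).
have [eta0 eta00 snap] := snap_to_sphere b gpa e0.
pose eta := Num.min (Num.min e (N * m)) eta0.
have eta_gt0 : 0 < eta by rewrite !lt_min e0 eta00 mulr_gt0.
have eta_e : eta <= e by rewrite !ge_min lexx.
have eta_m : eta <= N * m by rewrite !ge_min lexx !orbT.
have eta_eta0 : eta <= eta0 by rewrite !ge_min lexx !orbT.
exists e, eta, P, c; split.
- by rewrite eta_gt0.
- move=> q i qe qi.
  have re : 0 <= r ^+ 2 + e by rewrite addr_ge0 ?sqr_ge0 // ltW.
  have qb : enorm2 (cen q) <= b.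
    apply: (@le_trans _ _ (2 * (r ^+ 2 + e) + 2 * enorm2 (a i))); last first.
      rewrite /b (bigD1 i) //= lerDl sumr_ge0 // => j _.
      by rewrite addr_ge0 // mulr_ge0 // enorm2_ge0.
    have h : enorm2 (a i - cen q) <= r ^+ 2 + e.
      by move: qi; rewrite pwE => qi; lra.
    have : 0 <= enorm2 (2 *: a i - cen q) by exact: enorm2_ge0.
    move: h; rewrite !enorm2B !enorm2E !(dotZl, dotZr); lra.
  have [|p [pq pI pJ]] := snap eta q _ qb; first by rewrite eta_gt0.
  (* The site [i] has power at least [eta] at [q], so it is strictly inside [p]. *)
  have /gap : 0 < sq p.
    by apply: lt_le_trans (pw_le_sq (a i) p); rewrite pI.
  have <- : inside a p = [set i | (eta <= pw (a i) q)%R]%SET.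
    by apply/setP => j; rewrite !inE pI.
  have <- : inside_on a p = [set i | (- eta < pw (a i) q)%R]%SET.
    by apply/setP => j; rewrite !inE pJ.
  apply; apply: le_lt_trans pq _; rewrite e'E; lra.
- by move=> K /HP[].
- by move=> K /HP[].
- by move=> K /HP[].
- move=> K i hK iK; apply: le_trans eta_m _; rewrite ler_wpM2l ?(ltW N0) //.
  exact: (Pm (K, i)).
- by move=> K j hK jK; exact: Hc.
Qed.

(** * Homotopies at a fixed index (r, k) *)

Section Core.
Variables (r : R) (k : nat) (e eta : R) (P : face n -> 'rV[R]_(d + 1)) (c : face n -> 'rV[R]_d).
Hypotheses (k_gt0 : (1 <= k)%N) (bd : bridge_data r e eta P c).

Let eta_gt0 : 0 < eta. Proof. by have /andP[] := bd_eta bd. Qed.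
Let eta_le_e : eta <= e. Proof. by have /andP[] := bd_eta bd. Qed.
Let pt := blend a r k P.
Let ct := blend a r k c.

Let validW K : valid a r k K -> adm a r K.1 K.2.
Proof. by move=> /asboolP[]. Qed.

(** A tile with nonzero weight at [lam] cannot exclude a site of coefficient 1, so its centre lies
    in the ball around that site. *)
Lemma ct_ball lam i : tiles a r k lam -> lam ord0 i = 1 -> enorm2 (ct lam - a i) <= r ^+ 2.
Proof.
move=> tl l1; apply: ball_conv => [K||K]; [exact: nweight_ge0|exact: nweight_sum|].
move=> /nweight_neq0[vK _ h]; apply: (bd_ball bd); first exact: validW.
by apply: contraT => /h; rewrite l1 => ?; lra.
Qed.

Lemma pt_sq lam : tiles a r k lam -> sq (pt lam) <= r ^+ 2 + e.
Proof.
move=> tl; apply: sq_conv => [K||K]; [exact: nweight_ge0|exact: nweight_sum|].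
by move=> /nweight_neq0[/validW vK _ _]; exact: bd_sq bd _ vK.
Qed.

Lemma pw_pt lam i : tiles a r k lam ->
  pw (a i) (pt lam) = \sum_K nweight a r k K lam * pw (a i) (P K).
Proof. by move=> tl; rewrite pw_conv //; exact: nweight_sum. Qed.

(** No tile of nonzero weight excludes the site, so all terms are nonnegative, and the term of [K]
    alone reaches [eta]. *)
Lemma pw_pt_inside K lam i : valid a r k K -> box K.1 K.2 lam -> i \in K.1 ->
  eta <= pw (a i) (pt lam).
Proof.
move=> vK l iK; have tl : tiles a r k lam by apply/tilesP; exists K.
have [_ /(_ iK) l1 _] := l i.
have pos K' : 0 <= nweight a r k K' lam * pw (a i) (P K').
  have [->|/nweight_neq0[/validW vK' _ h]] := eqVneq (nweight a r k K' lam) 0.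
    by rewrite mul0r.
  rewrite mulr_ge0 ?nweight_ge0 //.
  suff : i \in inside_on a (P K') by rewrite inE.
  rewrite (bd_inside_on bd vK'); apply: contraT => /h; rewrite l1 => ?; lra.
rewrite pw_pt // (bigD1 K) //= ler_wpDr ?sumr_ge0 //.
apply: le_trans (bd_margin bd (validW vK) iK) _; rewrite ler_wpM2r ?nweight_box //.
by move: iK; rewrite -(bd_inside bd (validW vK)) inE => /ltW.
Qed.

(** Some tile of nonzero weight has the site strictly inside its sphere, which forces its
    coefficient above 3/4. *)
Lemma pw_pt_gt0 lam i : tiles a r k lam -> 0 < pw (a i) (pt lam) -> sharpen lam ord0 i = 1.
Proof.
move=> tl; rewrite pw_pt // => gt0.
have [K [wK pK]] : exists K, nweight a r k K lam != 0 /\ 0 < pw (a i) (P K).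
  apply: contrapT => /forallNP H; move: gt0; rewrite ltNge sumr_le0 // => K _.
  have [->|wK] := eqVneq (nweight a r k K lam) 0; first by rewrite mul0r.
  rewrite mulr_ge0_le0 ?nweight_ge0 // leNgt; apply/negP => pK; exact: (H K).
have [/validW vK h _] := nweight_neq0 wK; apply: sharpen1; apply/ltW/h.
by rewrite -(bd_inside bd vK) inE.
Qed.

Lemma pw_pt_lt0 lam i : tiles a r k lam -> pw (a i) (pt lam) < 0 -> sharpen lam ord0 i = 0.
Proof.
move=> tl; rewrite pw_pt // => lt0.
have [K [wK pK]] : exists K, nweight a r k K lam != 0 /\ pw (a i) (P K) < 0.
  apply: contrapT => /forallNP H; move: lt0; rewrite ltNge sumr_ge0 // => K _.
  have [->|wK] := eqVneq (nweight a r k K lam) 0; first by rewrite mul0r.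
  rewrite mulr_ge0 ?nweight_ge0 // leNgt; apply/negP => pK; exact: (H K).
have [/validW vK _ h] := nweight_neq0 wK; apply: sharpen0; apply/ltW/h.
by rewrite -(bd_inside_on bd vK) inE -ltNge.
Qed.

(** The membership test behind the homotopies through [of_point] and [of_tile]. As k >= 1, [M]
    supplies the site that [bd_adm] asks for. *)
Lemma tiles_near_sphere q M mu : (k <= #|M|)%N -> sq q <= r ^+ 2 + e ->
  (forall i, i \in M -> eta <= pw (a i) q) ->
  box [set i | (eta <= pw (a i) q)%R]%SET [set i | (- eta < pw (a i) q)%R]%SET mu ->
  tiles a r k mu.
Proof.
move=> kM qe Mq bmu; have /card_gt0P[i iM] : (0 < #|M|)%N by exact: leq_trans kM.
exists [set i | (eta <= pw (a i) q)%R]%SET, [set i | (- eta < pw (a i) q)%R]%SET.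
split=> //; first exact: (bd_adm bd qe (Mq i iM)).
apply: leq_trans kM (subset_leq_card _); apply/fintype.subsetP => j /Mq.
by rewrite inE.
Qed.

(** Powers for the sphere of squared radius r^2 + e around [x]; the excess [e] gives every site
    within [r] of [x] coefficient 1. *)
Let power (x : 'rV[R]_d) (i : 'I_n) : R := r ^+ 2 + e - enorm2 (x - a i).
Let of_point x := tile_of eta (power x).
Let of_tile lam := tile_of eta (fun i => pw (a i) (pt lam)).

Let powerE x i : power x i = pw (a i) (sph x (r ^+ 2 + e)).
Proof. by rewrite pw_sph enorm2Bsym. Qed.

Lemma power_ge x i : enorm2 (x - a i) <= r ^+ 2 -> eta <= power x i.
Proof. by move: eta_le_e; rewrite /power; lra. Qed.

Lemma of_point_tiles x : Cov a r k x -> tiles a r k (of_point x).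
Proof.
rewrite CovE => xk; apply: (@tiles_near_sphere (sph x (r ^+ 2 + e)) _ _ xk).
- by rewrite sq_sph.
- by move=> i; rewrite inE -powerE => /power_ge.
rewrite (_ : [set i | _]%SET = [set i | (eta <= power x i)%R]%SET); last first.
  by apply/setP => i; rewrite !inE powerE.
rewrite (_ : [set i | (- eta < pw _ _)%R]%SET = [set i | (- eta < power x i)%R]%SET); last first.
  by apply/setP => i; rewrite !inE powerE.
exact: tile_of_box.
Qed.

Let continuous_of_point : continuous of_point.
Proof.
apply: continuous_tile_of => i; apply: continuous_sub; first exact: cst_continuous.
by apply: continuous_enorm2B => x; exact: cvg_id.
Qed.

Let continuous_pw_pt i : continuous (fun lam => pw (a i) (pt lam)).
Proof.
apply: continuous_sub; last exact: cst_continuous.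
by apply: continuous_dot; exact: continuous_blend.
Qed.

Let continuous_of_tile : continuous of_tile.
Proof. by apply: continuous_tile_of => i; exact: continuous_pw_pt. Qed.

(** Powers are affine in the sphere, so joining the spheres joins the powers. Inner sites of a tile
    of [lam] have power at least [eta] at both ends, hence throughout. *)
Lemma of_point_of_tile : ghomotopic (bridge r k) (tiles a r k)
  (fun x => of_point x.2) (fun x => of_tile x.1).
Proof.
pose g (z : 'rV[R]_n * 'rV[R]_d * R) i :=
  (1 - z.2) * power z.1.2 i + z.2 * pw (a i) (pt z.1.1).
exists (fun z => tile_of eta (g z)); split.
- apply: continuous_tile_of => i; apply: continuous_add; apply: continuous_mul.
  + by apply: continuous_sub; [exact: cst_continuous|exact: continuous_snd].
  + apply: continuous_sub; first exact: cst_continuous.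
    apply: continuous_enorm2B.
    exact: (continuous_compose (@continuous_fst _ _) (@continuous_snd _ _)).
  + exact: continuous_snd.
  + apply: (continuous_compose _ (continuous_pw_pt (i := i))).
    exact: (continuous_compose (@continuous_fst _ _) (@continuous_fst _ _)).
- move=> [lam x] t [/= tl lx] t01.
  have [K vK lK] := (tilesP a r k lam).1 tl; have [_ kK] := asboolP _ vK.
  pose q := (1 - t) *: sph x (r ^+ 2 + e) + t *: pt lam.
  have gq i : g (lam, x, t) i = pw (a i) q by rewrite pw_lerp -powerE.
  apply: (@tiles_near_sphere q _ _ kK).
  + by apply: sq_lerp => //; [rewrite sq_sph|exact: pt_sq].
  + move=> i iK; rewrite -gq /g /=; have [_ /(_ iK) l1 _] := lK i.
    have h1 := power_ge (lx i l1); have h2 := pw_pt_inside vK lK iK.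
    by move: t01 => /andP[t0 t1]; nra.
  + rewrite (_ : tile_of _ _ = tile_of eta (fun i => pw (a i) q)); first exact: tile_of_box.
    by congr tile_of; apply/funext.
- move=> [lam x] _ /=; split; congr tile_of; apply/funext => i; rewrite /g /=.
    by rewrite subr0 mul1r mul0r addr0.
  by rewrite subrr mul1r mul0r add0r.
Qed.

(** Both ends lie in the box attached to the sphere [pt lam], so the segment does. *)
Lemma of_tile_sharpen : ghomotopic (bridge r k) (tiles a r k)
  (fun x => of_tile x.1) (fun x => sharpen x.1).
Proof.
apply: ghomotopic_lerp.
- exact: (continuous_compose (@continuous_fst _ _) continuous_of_tile).
- exact: (continuous_compose (@continuous_fst _ _) (@continuous_sharpen _ _)).
move=> [lam x] t [/= tl _] t01.
have [K vK lK] := (tilesP a r k lam).1 tl; have [_ kK] := asboolP _ vK.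
apply: (@tiles_near_sphere (pt lam) _ _ kK); first exact: pt_sq.
  by move=> i; exact: pw_pt_inside.
apply: box_lerp => //; first exact: tile_of_box.
move=> i; split.
- by rewrite mxE clamp01.
- by rewrite inE => h; apply: pw_pt_gt0 => //; exact: lt_le_trans h.
- rewrite inE -leNgt => h; apply: pw_pt_lt0 => //; apply: le_lt_trans h _.
  by rewrite oppr_lt0.
Qed.

Lemma sharpen_fst : ghomotopic (bridge r k) (tiles a r k)
  (fun x => sharpen x.1) (fun x => x.1).
Proof.
apply: ghomotopic_lerp.
- exact: (continuous_compose (@continuous_fst _ _) (@continuous_sharpen _ _)).
- exact: continuous_fst.
move=> [lam x] t [/= /tilesP[K vK lK] _] t01; apply/tilesP; exists K => //.
by apply: box_lerp => //; exact: sharpen_box.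
Qed.

Lemma of_point_fst : ghomotopic (bridge r k) (tiles a r k)
  (fun x => of_point x.2) (fun x => x.1).
Proof.
apply: ghomotopic_trans of_point_of_tile _.
  exact: (continuous_compose (@continuous_fst _ _) continuous_of_tile).
apply: ghomotopic_trans of_tile_sharpen sharpen_fst.
exact: (continuous_compose (@continuous_fst _ _) (@continuous_sharpen _ _)).
Qed.

Let section_of lam : 'rV[R]_n * 'rV[R]_d := (lam, ct lam).

Let continuous_section_of : continuous section_of.
Proof. by apply: continuous_pair => [x|]; [exact: cvg_id|exact: continuous_blend]. Qed.

Lemma section_of_bridge lam : tiles a r k lam -> bridge r k (section_of lam).
Proof. by move=> tl; split=> //= i; exact: ct_ball. Qed.

(** Only the second component moves, within an intersection of balls. *)
Lemma section_of_id : ghomotopic (bridge r k) (bridge r k) (fun x => section_of x.1) id.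
Proof.
apply: ghomotopic_lerp.
- exact: (continuous_compose (@continuous_fst _ _) continuous_section_of).
- by move=> x; exact: cvg_id.
move=> [lam x] t [/= tl lx] t01.
have lamE : (1 - t) *: lam + t *: lam = lam by rewrite -scalerDl subrK scale1r.
split=> /=; first by rewrite lamE.
by move=> i; rewrite lamE => l1; apply: ball_lerp => //; [exact: ct_ball|exact: lx].
Qed.

Lemma section_of_point_id :
  ghomotopic (bridge r k) (bridge r k) (fun x => section_of (of_point x.2)) id.
Proof.
apply: ghomotopic_trans section_of_id.
  exact: (continuous_compose (@continuous_fst _ _) continuous_section_of).
have [H [cH HY Hfg]] := of_point_fst; exists (fun z => section_of (H z)); split.
- exact: (continuous_compose cH continuous_section_of).
- by move=> x t Xx t01; apply/section_of_bridge/HY.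
- by move=> x /Hfg[-> ->].
Qed.

Lemma bridge_cov : maps_into (fun x : 'rV[R]_n * 'rV[R]_d => x.2) (bridge r k) (Cov a r k).
Proof.
move=> [lam x] [/= [I [J [_ kI l]]] lx]; rewrite CovE; apply: leq_trans kI (subset_leq_card _).
by apply/fintype.subsetP => i iI; rewrite inE; apply: lx; have [_ /(_ iI)] := l i.
Qed.

Lemma bridge_cov_equiv : @homotopy_equiv R _ _ (bridge r k) (Cov a r k) (fun x => x.2).
Proof.
split; first exact: bridge_cov.
split; first by apply: continuous_subspaceT; exact: continuous_snd.
have cg : continuous (fun x => section_of (of_point x)).
  exact: continuous_compose continuous_of_point continuous_section_of.
exists (fun x => section_of (of_point x)); split.
  by move=> x /of_point_tiles; exact: section_of_bridge.
split; first exact: continuous_subspaceT.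
split; first exact: (ghomotopic_homotopic section_of_point_id).
apply: ghomotopic_homotopic; apply: ghomotopic_lerp.
- exact: (continuous_compose cg (@continuous_snd _ _)).
- by move=> x; exact: cvg_id.
(* Each site within [r] of [x] has coefficient 1 in [of_point x], so its ball contains both ends of
   the segment and no site is lost. *)
move=> x t xk t01; rewrite CovE; have := xk; rewrite CovE => /leq_trans; apply.
apply: subset_leq_card.
apply/fintype.subsetP => i; rewrite !inE => xi; apply: ball_lerp => //=.
apply: ct_ball; first exact: of_point_tiles.
by apply: tile_of1 => //; exact: power_ge.
Qed.

Hypothesis gpa : general_position a.
Hypothesis r_ge0 : 0 <= r.

(** A chosen preimage, with default 0 outside the rhomboid tiling; [embK] shows that there was no
    choice on it. *)
Let unemb (x : 'rV[R]_(d + 1)) : 'rV[R]_n := xget 0 [set lam | tiles a r k lam /\ x = emb a lam].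

Let unembP x : Rhomb a r k x -> tiles a r k (unemb x) /\ emb a (unemb x) = x.
Proof.
move=> /(RhombE _ _ _ r_ge0)[lam tl xl].
by have [|h1 h2] := @xgetPex _ 0 [set lam | tiles a r k lam /\ x = emb a lam]; [exists lam|].
Qed.

Lemma embK lam : tiles a r k lam -> unemb (emb a lam) = lam.
Proof.
move=> tl; have [C _ CP] := tiles_expansive r k gpa.
have [|t1 t2] := @unembP (emb a lam); first by apply/RhombE => //; exists lam.
apply/rowP => i; apply/eqP; rewrite -subr_eq0 -normr_le0.
apply: le_trans (CP _ _ t1 tl i) _; rewrite t2 subrr /norm1 big1 ?mulr0 // => l _.
by rewrite mxE normr0.
Qed.

Lemma continuous_unemb : {within Rhomb a r k, continuous unemb}.
Proof.
have [C C0 CP] := tiles_expansive r k gpa.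
apply/subspace_continuousP => x Xx; apply/cvg_ballP => eps eps0.
have cN : continuous (fun y : 'rV[R]_(d + 1) => C * norm1 ((x : 'rV[R]_(d + 1)) - y)).
  apply: continuous_mul; first exact: cst_continuous.
  apply: continuous_sumr => l.
  apply: (continuous_compose (g := fun t : R => `|t|)); last exact: (@norm_continuous R R^o).
  apply: continuous_entry => y; apply: continuousB; first exact: cst_continuous.
  exact: cvg_id.
have /cvgrPdist_lt/(_ eps eps0) := cN x; apply: filterS => y.
rewrite subrr {1}/norm1 big1 => [|l _]; last by rewrite mxE normr0.
rewrite mulr0 sub0r normrN ger0_norm ?mulr_ge0 ?norm1_ge0 // => xy Xy.
have [tx xE] := unembP Xx; have [ty yE] := unembP Xy.
split=> // i j; rewrite [i]ord1 /ball /=.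
by apply: le_lt_trans (CP _ _ tx ty j) _; rewrite xE yE.
Qed.

Lemma bridge_rhomb :
  maps_into (fun x : 'rV[R]_n * 'rV[R]_d => emb a x.1) (bridge r k) (Rhomb a r k).
Proof. by move=> x [tx _]; apply/RhombE => //; exists x.1. Qed.

Lemma continuous_emb : continuous (emb a).
Proof.
apply: continuous_sumr => i; apply: continuous_scale; last exact: cst_continuous.
exact: coord_continuous.
Qed.

Lemma bridge_rhomb_equiv :
  @homotopy_equiv R _ _ (bridge r k) (Rhomb a r k) (fun x => emb a x.1).
Proof.
split; first exact: bridge_rhomb.
split.
  apply: continuous_subspaceT; exact: (continuous_compose (@continuous_fst _ _) continuous_emb).
exists (fun x => section_of (unemb x)); split.
  by move=> x /unembP[tx _]; exact: section_of_bridge.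
split.
  exact: (@continuous_compose (subspace (Rhomb a r k)) _ _ unemb section_of
    continuous_unemb continuous_section_of).
split.
  apply: ghomotopic_homotopic; apply: ghomotopic_eq section_of_id.
  by move=> x; rewrite inE => -[tx _] /=; rewrite embK.
(* The constant homotopy: this composition is the identity on [Rhomb a r k]. *)
exists (fun z => z.1); split; first by apply: continuous_subspaceT; exact: continuous_fst.
by split=> // x Xx /=; have [_ ->] := unembP Xx.
Qed.

End Core.

Lemma tiles_mono (r r' : R) (k k' : nat) lam : 0 <= r -> r <= r' -> (k' <= k)%N ->
  tiles a r k lam -> tiles a r' k' lam.
Proof.
move=> r0 rr' kk' [I [J [IJ kI l]]]; exists I, J; split=> //; first exact: adm_mono IJ.
exact: leq_trans kI.
Qed.

Lemma le_sqr (r r' : R) : 0 <= r -> r <= r' -> r ^+ 2 <= r' ^+ 2.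
Proof. by move=> r0 rr'; rewrite ler_sqr // nnegrE // (le_trans r0). Qed.

Lemma bridge_bifilt : is_bifilt (BiFilt bridge).
Proof.
move=> r r' k k' r0 rr' _ kk' [lam x] [/= tl lx]; split; first exact: tiles_mono tl.
by move=> i l1; rewrite (le_trans (lx i l1)) // le_sqr.
Qed.

Lemma Rhomb_bifilt : is_bifilt (RhombBF a).
Proof.
move=> r r' k k' r0 rr' _ kk' x /(RhombE _ _ _ r0)[lam tl ->].
apply/RhombE; first exact: le_trans rr'.
by exists lam => //; exact: tiles_mono tl.
Qed.

Lemma Cov_bifilt : is_bifilt (CovBF a).
Proof.
move=> r r' k k' r0 rr' _ kk' x; rewrite /= !CovE => xk.
apply: leq_trans kk' (leq_trans xk (subset_leq_card _)).
apply/fintype.subsetP => i; rewrite !inE => /le_trans; apply; exact: le_sqr.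
Qed.

End Equivalences.

Theorem theorem11 (R : realType) (d n : nat) (a : 'I_n -> 'rV[R]_d) :
  general_position a -> weakly_equivalent (RhombBF a) (CovBF a).
Proof.
move=> gpa; split; first exact: Rhomb_bifilt.
(* Only the two projections must commute with inclusions, and they do not depend on the index; the
   constants and homotopy inverses may vary with it. *)
apply: (@zz_bwd _ _ (BiFilt (bridge a))); first exact: bridge_bifilt.
  exists (fun _ _ x => emb a x.1); split=> // r k r0 k0.
  have [e [eta [P [c bd]]]] := exists_bridge_data gpa r0.
  exact: bridge_rhomb_equiv bd gpa r0.
apply: (@zz_fwd _ _ (CovBF a)); [exact: Cov_bifilt| |exact: zz_refl].
exists (fun _ _ x => x.2); split=> // r k r0 k0.
have [e [eta [P [c bd]]]] := exists_bridge_data gpa r0.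
exact: bridge_cov_equiv k0 bd.
Qed.
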